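(* Let $u,w\in\mathcal{D}(E)$ be such that $T=M_wEM_u$, $T(f)=wE(uf)$, is a bounded operator on $L^2(\Sigma)$, and let $T=U|T|$ be its polar decomposition. Let $r>0$ and $r\geq t\geq 0$. Then the generalized Aluthge transformation $\widetilde{T}=|T|^{t}U|T|^{r-t}$ is a normal operator on $L^2(\Sigma)$.
   Context: $(X,\Sigma,\mu)$ is a complete $\sigma$-finite measure space and $\mathcal{A}\subseteq\Sigma$ is a sub-$\sigma$-algebra such that $\mu|_{\mathcal{A}}$ is $\sigma$-finite; functions are complex-valued, $L^2(\Sigma)=L^2(X,\Sigma,\mu)$, and all statements about functions and sets hold up to $\mu$-null sets. $L^0(\Sigma)$ (resp. $L^0(\mathcal{A})$) is the space of classes of a.e. finite-valued $\Sigma$-measurable (resp. $\mathcal{A}$-measurable) functions. $E=E^{\mathcal{A}}$ is the conditional expectation with respect to $\mathcal{A}$: $E(f)$ is the unique $\mathcal{A}$-measurable function with $\int_A f\,d\mu=\int_A E(f)\,d\mu$ for all $A\in\mathcal{A}$ for nonnegative measurable $f$ (values in $[0,\infty]$), similarly for $f\in L^2(\Sigma)$ (for $A$ of finite measure), and extended by linearity to $\mathcal{D}(E)=\{g\in L^0(\Sigma): E(|g|)\in L^0(\mathcal{A})\}$. $M_u$, $M_w$ denote multiplication by $u$, $w$, and $M_wEM_u$ is the operator $f\mapsto wE(uf)$; boundedness on $L^2(\Sigma)$ means in particular that $uf\in\mathcal{D}(E)$ for all $f\in L^2(\Sigma)$. The polar decomposition $T=U|T|$ has $|T|=(T^*T)^{1/2}$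 and $U$ the partial isometry with $\mathcal{N}(U)=\mathcal{N}(|T|)$. Positive powers $|T|^s$ are given by functional calculus; $|T|^0$ is the orthogonal projection onto the closure of the range of $|T|$. *)

(* Defs.v *)
From HB Require Import structures.
From mathcomp Require Import all_boot all_order all_algebra.
From mathcomp Require Import generic_quotient ring_quotient complex.
From mathcomp Require Import all_classical all_reals all_analysis.
From mathcomp Require Import measurable_realfun.

Set Implicit Arguments.
Unset Strict Implicit.
Unset Printing Implicit Defensive.

Import Order.TTheory GRing.Theory Num.Theory.

Local Open Scope classical_set_scope.
Local Open Scope ring_scope.
Local Open Scope complex_scope.

Local Notation Re := complex.Re.
Local Notation Im := complex.Im.
Local Notation normc := ComplexField.Normc.normc.

Section L2space.
Context d (X : measurableType d) (R : realType).
Variable mu : {measure set X -> \bar R}.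
Local Notation C := R[i].
Implicit Types f g : X -> C.

Definition cmeasurable f : Prop :=
  measurable_fun setT (fun x => Re (f x)) /\
  measurable_fun setT (fun x => Im (f x)).

Lemma measurable_normc f :
  cmeasurable f -> measurable_fun setT (fun x => normc (f x)).
Proof.
move=> [mr mi].
have -> : (fun x => normc (f x)) =
  (fun x => (Re (f x) ^+ 2 + Im (f x) ^+ 2) `^ 2^-1).
  apply/funext => x; rewrite powR12_sqrt ?addr_ge0 ?sqr_ge0//.
  by rewrite /normc; case: (f x).
apply: (measurableT_comp (measurable_powR _)).
by apply: measurable_funD; exact: measurable_funX.
Qed.

Lemma cmeasurable0 : cmeasurable (fun=> 0).
Proof. by split; exact: measurable_cst. Qed.

Lemma cmeasurableD f g :
  cmeasurable f -> cmeasurable g -> cmeasurable (fun x => f x + g x).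
Proof.
move=> [fr fi] [gr gi]; split.
  rewrite (_ : (fun x => _) = (fun x => Re (f x)) \+ (fun x => Re (g x))).
    exact: measurable_funD.
  by apply/funext => x /=; case: (f x) => ? ?; case: (g x).
rewrite (_ : (fun x => _) = (fun x => Im (f x)) \+ (fun x => Im (g x))).
  exact: measurable_funD.
by apply/funext => x /=; case: (f x) => ? ?; case: (g x).
Qed.

Lemma cmeasurableM f g :
  cmeasurable f -> cmeasurable g -> cmeasurable (fun x => f x * g x).
Proof.
move=> [fr fi] [gr gi]; split.
  rewrite (_ : (fun x => _) = ((fun x => Re (f x)) \* (fun x => Re (g x))) \-
    ((fun x => Im (f x)) \* (fun x => Im (g x)))).
    by apply: measurable_funB; exact: measurable_funM.
  by apply/funext => x /=; case: (f x) => ? ?; case: (g x).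
rewrite (_ : (fun x => _) = ((fun x => Re (f x)) \* (fun x => Im (g x))) \+
  ((fun x => Im (f x)) \* (fun x => Re (g x)))).
  by apply: measurable_funD; exact: measurable_funM.
by apply/funext => x /=; case: (f x) => ? ?; case: (g x).
Qed.

Definition finite_L2norm f : Prop :=
  finite_norm mu 2%:E (fun x => normc (f x)).

Definition L2pred : {pred X -> C^o} :=
  mem [set f : X -> C^o | cmeasurable f /\ finite_L2norm f].

Let le_finite_norm (a b : X -> R) :
  measurable_fun setT a -> measurable_fun setT b ->
  (forall x, 0 <= a x <= b x) ->
  finite_norm mu 2%:E b -> finite_norm mu 2%:E a.
Proof.
move=> ma mb ab; rewrite /finite_norm; apply: le_lt_trans.
have mpow (c : X -> R) : measurable_fun setT c ->
    measurable_fun setT (fun x => `|(EFin \o c) x| `^ 2)%E.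
  move=> mc; rewrite (_ : (fun x => _) = EFin \o (fun x => `|c x| `^ 2)) //.
  apply/measurable_EFinP/(measurableT_comp (measurable_powR _)).
  exact: measurableT_comp.
rewrite unlock gt0_ler_poweR//.
- by rewrite in_itv/= leey integral_ge0// => x _; exact: poweR_ge0.
- by rewrite in_itv/= leey integral_ge0// => x _; exact: poweR_ge0.
apply: ge0_le_integral => //.
- by move=> x _; exact: poweR_ge0.
- exact: mpow.
- exact: mpow.
move=> x _ /=; have /andP[a0 le_ab] := ab x.
rewrite lee_fin !ger0_norm ?(le_trans a0)// ge0_ler_powR//.
by rewrite nnegrE (le_trans a0).
Qed.

Lemma L2_submod_closed : submod_closed L2pred.
Proof.
split.
  rewrite inE/=; split; first exact: cmeasurable0.
  rewrite /finite_L2norm (_ : (fun x => _) = cst 0).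
    exact: finite_norm_cst0 (lee1n 2).
  by apply/funext => x /=; rewrite expr0n/= addr0 sqrtr0.
move=> a f g; rewrite !inE/= => -[mf ff] [mg fg].
have maf : cmeasurable (fun x => a * f x).
  by apply: cmeasurableM => //; split; exact: measurable_cst.
split; first exact: cmeasurableD.
apply: (@le_finite_norm _ ((fun x => normc a * normc (f x)) \+ (fun x => normc (g x)))).
- by apply: measurable_normc; exact: cmeasurableD.
- apply: measurable_funD; last exact: measurable_normc.
  by apply: measurable_funM => //; exact: measurable_normc.
- move=> x; apply/andP; split.
    by rewrite /normc; case: (_ x) => *; exact: sqrtr_ge0.
  by rewrite /= (le_trans (le_normcD _ _))// ComplexField.Normc.normcM.
rewrite /finite_norm (le_lt_trans (eminkowski _ _ _ _))//.
- by apply: measurable_funM => //; exact: measurable_normc.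
- exact: measurable_normc.
- by rewrite lee1n.
rewrite lte_add_pinfty//.
have fL : (fun x => normc (f x)) \in Lfun mu 2%:E.
  by rewrite inE/=; apply/andP; split; rewrite inE//=; exact: measurable_normc.
have := Lfun_scale (normc a) (ler1n _ 2) fL.
rewrite inE => /andP[_]; rewrite inE/= /finite_norm.
rewrite (_ : _ \o* _ = (fun x => normc a * normc (f x)))//.
by apply/funext => x; rewrite /= mulrC.
Qed.

HB.instance Definition _ :=
  GRing.isSubmodClosed.Build C (X -> C^o) L2pred L2_submod_closed.

Record L2fun := MkL2fun { L2fun_val :> X -> C^o ; L2fun_in : L2fun_val \in L2pred }.

HB.instance Definition _ := [isSub for L2fun_val].
HB.instance Definition _ := [Choice of L2fun by <:].
HB.instance Definition _ := [SubChoice_isSubLmodule of L2fun by <:].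

End L2space.

Section L2quotient.
Context d (X : measurableType d) (R : realType).
Variable mu : {measure set X -> \bar R}.
Local Notation C := R[i].
Local Notation L2fun := (L2fun mu).
Implicit Types f g : L2fun.

Definition L2null : {pred L2fun} :=
  mem [set f : L2fun | \forall x \ae mu, (f : X -> C) x = 0].

Lemma L2null_submod_closed : submod_closed L2null.
Proof.
split.
  by rewrite inE/=; exact: aeW.
move=> a f g; rewrite !inE/=; apply: filterS2 => x f0 g0 /=.
by rewrite -[LHS]/(a * L2fun_val f x + L2fun_val g x) f0 g0 mulr0 addr0.
Qed.

HB.instance Definition _ :=
  GRing.isSubmodClosed.Build C L2fun L2null L2null_submod_closed.

Definition L2 : Type := Quotient.quot L2null.

HB.instance Definition _ := Choice.on L2.
HB.instance Definition _ := EqQuotient.on L2.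
HB.instance Definition _ := GRing.Zmodule.on L2.

Definition L2_class (f : L2fun) : L2 := (\pi_L2 f)%qT.

Lemma L2_classP f g : L2_class f = L2_class g <-> f - g \in L2null.
Proof.
rewrite (@Quotient.idealrBE _ (L2null : zmodClosed _)).
split => [h|/eqP h]; [exact/eqP|exact: h].
Qed.

Definition L2_scale (a : C) (F : L2) : L2 := L2_class (a *: repr F).

Lemma L2_scale_class a f : L2_scale a (L2_class f) = L2_class (a *: f).
Proof.
apply/L2_classP; rewrite -scalerBr rpredZ//; apply/L2_classP.
by rewrite /L2_class reprK.
Qed.

Lemma L2_classD f g : L2_class (f + g) = L2_class f + L2_class g.
Proof. exact: (raddfD (\pi_(Quotient.quot (L2null : zmodClosed L2fun)))%qT). Qed.

Let L2_ind (P : L2 -> Prop) : (forall f, P (L2_class f)) -> forall F, P F.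
Proof. by move=> h F; rewrite -[F]reprK; exact: h. Qed.

Let L2_scaleA a b F : L2_scale a (L2_scale b F) = L2_scale (a * b) F.
Proof. by elim/L2_ind: F => f; rewrite !L2_scale_class scalerA. Qed.

Let L2_scale1 : left_id 1 L2_scale.
Proof. by elim/L2_ind => f; rewrite L2_scale_class scale1r. Qed.

Let L2_scaleDr : right_distributive L2_scale +%R.
Proof.
move=> a; elim/L2_ind => f; elim/L2_ind => g.
by rewrite -L2_classD !L2_scale_class scalerDr L2_classD.
Qed.

Let L2_scaleDl F : {morph L2_scale^~ F : a b / a + b}.
Proof.
by move=> a b /=; elim/L2_ind: F => f; rewrite !L2_scale_class scalerDl L2_classD.
Qed.

HB.instance Definition _ := GRing.Zmodule_isLmodule.Build C L2
  L2_scaleA L2_scale1 L2_scaleDr L2_scaleDl.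

(* Representatives are only meaningful up to mu-null sets. *)
Definition L2_repr (F : L2) : X -> C := repr F.

Lemma L2_eqP (F G : L2) : F = G <-> L2_repr F = L2_repr G %[ae mu].
Proof.
rewrite -[X in X = _ <-> _]reprK -[X in _ = X <-> _]reprK.
rewrite [X in X <-> _]L2_classP inE/=.
by split; apply: filterS => x /= h; [move=> _; apply/eqP; rewrite -subr_eq0;
  apply/eqP|apply/eqP; rewrite subr_eq0; apply/eqP; exact: h].
Qed.

Lemma L2_repr_class f : L2_repr (L2_class f) = (f : X -> C) %[ae mu].
Proof.
have : L2_class (repr (L2_class f)) = L2_class f by rewrite /L2_class reprK.
by rewrite L2_classP inE/=; apply: filterS => x /= h _; apply/eqP;
  rewrite -subr_eq0; apply/eqP.
Qed.

Lemma L2_reprD F G :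
  L2_repr (F + G) = (fun x => L2_repr F x + L2_repr G x) %[ae mu].
Proof.
rewrite -[F in L2_repr (F + _)]reprK -[G in L2_repr (_ + G)]reprK.
by rewrite -[X in L2_repr X](L2_classD (repr F) (repr G)); exact: L2_repr_class.
Qed.

Lemma L2_reprZ a F : L2_repr (a *: F) = (fun x => a * L2_repr F x) %[ae mu].
Proof. exact: (L2_repr_class (a *: repr F)). Qed.

End L2quotient.

Coercion L2_repr : L2 >-> Funclass.

Section Operators.
Context d (X : measurableType d) (R : realType).
Variable mu : {measure set X -> \bar R}.
Local Notation C := R[i].
Local Notation H := (L2 mu).
Implicit Types (F G : H) (S A B P U : H -> H) (z : C) (s : R).

Definition L2_norm F : R := fine 'N[ mu ]_2%:E[EFin \o (fun x => normc (F x))].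

Definition cintegral (h : X -> C) : C :=
  (\int[mu]_x Re (h x)) +i* (\int[mu]_x Im (h x)).

Definition inner F G : C := cintegral (fun x => F x * conjc (G x)).

Definition bounded_operator S : Prop :=
  linear S /\ exists M : R, forall F, L2_norm (S F) <= M * L2_norm F.

Definition is_adjoint S S' : Prop :=
  bounded_operator S' /\ forall F G, inner (S F) G = inner F (S' G).

Definition normal_operator S : Prop :=
  bounded_operator S /\
  exists2 S', is_adjoint S S' & forall F, S' (S F) = S (S' F).

Definition spectrum S : set C :=
  [set z | ~ exists2 B, bounded_operator B &
     forall F, B (S F - z *: F) = F /\ S (B F) - z *: B F = F].

Definition operator_poly (p : {poly C}) S F : H :=
  \sum_(i < size p) p`_i *: iter i S F.

(* Continuous functional calculus: [B = phi(S)] for a self-adjoint [S], i.e.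
   [B] is the value at [phi] of the continuous extension of [p |-> p(S)] from
   the polynomials with the sup norm on the spectrum of [S]. *)
Definition functional_calculus S (phi : C -> C) B : Prop :=
  bounded_operator B /\
  forall e : R, 0 < e -> exists2 delta : R, 0 < delta &
    forall p : {poly C},
      (forall z, spectrum S z -> normc (p.[z] - phi z) <= delta) ->
      forall F, L2_norm (operator_poly p S F - B F) <= e * L2_norm F.

Definition range_closure S : set H :=
  [set F | forall e : R, 0 < e -> exists G, L2_norm (F - S G) < e].

Definition orthogonal_projection (V : set H) P : Prop :=
  forall F, V (P F) /\ forall G, V G -> inner (F - P F) G = 0.

(* [B = A ^ s] for a positive operator [A] and [s >= 0]; [spectrum A] then lies
   in the nonnegative half-line, so that [Re z] is [z] on it. *)
Definition is_power A s B : Prop :=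
  if s == 0 then orthogonal_projection (range_closure A) B
  else functional_calculus A (fun z => (Re z `^ s)%:C) B.

Definition is_abs T A : Prop :=
  exists2 T', is_adjoint T T' & is_power (T' \o T) 2^-1 A.

Definition partial_isometry U : Prop :=
  bounded_operator U /\
  forall F, (forall G, U G = 0 -> inner F G = 0) -> L2_norm (U F) = L2_norm F.

Definition polar_decomposition T U A : Prop :=
  [/\ is_abs T A, partial_isometry U, forall F, T F = U (A F) &
      forall F, U F = 0 <-> A F = 0].

End Operators.

Section ConditionalExpectation.
Context d (X : measurableType d) (R : realType).
Variables (mu : {measure set X -> \bar R}) (A : set (set X)).
Local Notation C := R[i].

Definition sub_measurable (g : X -> \bar R) : Prop :=
  @measurable_fun _ _ (g_sigma_algebraType A) _ setT g.

(* Some version of [E(f)] for a nonnegative measurable [f], with values in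
   [[0, +oo]]. *)
Definition cond_exp_ge0 (f : X -> \bar R) : X -> \bar R :=
  xget (cst 0%E) [set g | [/\ sub_measurable g, forall x, (0 <= g x)%E &
    forall B, A B -> (\int[mu]_(x in B) f x = \int[mu]_(x in B) g x)%E]].

Definition cond_exp_dom (g : X -> C) : Prop :=
  cmeasurable g /\
  \forall x \ae mu, (cond_exp_ge0 (fun y => (normc (g y))%:E) x < +oo)%E.

Definition cond_exp_real (f : X -> R) (x : X) : R :=
  fine (cond_exp_ge0 ((EFin \o f)^\+)%E x) -
  fine (cond_exp_ge0 ((EFin \o f)^\-)%E x).

Definition cond_exp (g : X -> C) (x : X) : C :=
  cond_exp_real (fun y => Re (g y)) x +i* cond_exp_real (fun y => Im (g y)) x.

(* [T = M_w E M_u] as an everywhere defined operator on [L^2(mu)]. *)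
Definition is_MwEMu (w u : X -> C) (T : L2 mu -> L2 mu) : Prop :=
  forall F : L2 mu, cond_exp_dom (fun x => u x * F x) /\
    (T F : X -> C) = (fun x => w x * cond_exp (fun y => u y * F y) x) %[ae mu].

End ConditionalExpectation.

(* Main.v *)
From HB Require Import structures.
Require Import Defs.
From mathcomp Require Import all_boot all_order all_algebra complex.
From mathcomp Require Import all_classical all_reals all_analysis.
From mathcomp Require Import measurable_realfun ring lra.
Import Order.TTheory GRing.Theory Num.Theory.
Import numFieldNormedType.Exports.
Local Open Scope classical_set_scope.
Local Open Scope ring_scope.

(** Write [P] for [|T|], [S] for [T' T] where [T'] is the adjoint of [T], and
[a f] for [E (u f)], so that [T f = w * a f].  The operator [T] commutes with
the multiplications by bounded [A]-measurable functions, and has rank one over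
these functions: [a f] being [A]-measurable, [T (a f * g - a g * f) = 0], up to
damping the coefficients to make them bounded.

Let [N] be a bounded operator such that [N] and its adjoint [N'] vanish on the
kernel of [T] and commute with the same multiplications.  Then
[a f * N g = a g * N f], and the same holds for [N'].  With [g = N' f] for [N],
and with [g = N f] for [N'], one gets
[[
  a f * N N' f = a (N' f) * N f,      a f * N' N f = a (N f) * N' f.
]]
The right-hand sides are equal.  Indeed, their difference is in the kernel of
[T] by the rank-one property, so both [N] and [N'] kill it; but it is also in
the sum of the ranges of [N] and [N'], which is orthogonal to those vectors that
both operators kill.  Hence [N N' f] and [N' N f] agree where [a f] is nonzero.
On the [A]-set where [a f = 0], they both vanish, because [T] kills the
restriction of [f] to that set.  So [N] is normal: this is [rank_one_normal].

It remains to see that [N = P^t U P^(r-t)] is of this kind.  [P] is a limit of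
polynomials in [S], and a positive power of [P] is a limit of polynomials in
[P]; the power zero is a projection.  In all cases the power is self-adjoint,
vanishes on the kernel of [T], and commutes with the multiplications, because
[S] does.  The partial isometry [U] commutes with them on the range of [P],
because [T = U P] and [P] do, hence on the closure of this range, which contains
the range of [P^(r-t)].  The adjoint of [N] is given by Riesz' theorem.

Using the functional calculus requires polynomials that are close to [x^s] on
the spectrum: these are Bernstein polynomials ([powR_approx_sqr]), once the
spectrum of a positive operator is known to lie in a segment
([positive_spectrum], from the Lax-Milgram theorem).  The theorems of Riesz and
of Lax-Milgram rest on the completeness of [L^2] ([L2_complete]).  Conditional
expectations enter only through the commutation of [T] with the characteristic
functions of [A]-sets, which follows from their existence (Radon-Nikodym) and
almost everywhere uniqueness. *)

Set Implicit Arguments.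
Unset Strict Implicit.
Unset Printing Implicit Defensive.

Local Notation Re := complex.Re.
Local Notation Im := complex.Im.
Local Notation normc := ComplexField.Normc.normc.

(** * The real inner product of [L^2] *)

Section L2_inner_product.
Context d (X : measurableType d) (R : realType).
Variable mu : {measure set X -> \bar R}.
Local Notation C := R[i].
Local Notation H := (L2 mu).
Implicit Types (F G K : H) (f g : X -> C) (z a : C) (r s : R).

(** The squared modulus; being polynomial in the parts, it avoids square roots. *)
Definition nsq z : R := Re z ^+ 2 + Im z ^+ 2.

Lemma nsqE z : nsq z = normc z ^+ 2.
Proof. by case: z => a b; rewrite /nsq /normc sqr_sqrtr// addr_ge0 ?sqr_ge0. Qed.

Lemma nsq_ge0 z : 0 <= nsq z.
Proof. by rewrite addr_ge0 ?sqr_ge0. Qed.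

Lemma nsq_eq0 z : nsq z = 0 -> z = 0.
Proof.
case: z => a b /eqP; rewrite /nsq /= paddr_eq0 ?sqr_ge0// !sqrf_eq0.
by case/andP => /eqP -> /eqP ->.
Qed.

Lemma cmeasurable_nsq f : cmeasurable f -> measurable_fun setT (fun x => nsq (f x)).
Proof. by move=> [mr mi]; apply: measurable_funD; exact: measurable_funX. Qed.

Lemma Lnorm_nsq f :
  ('N[mu]_2%:E[EFin \o (fun x => normc (f x))] `^ 2 = \int[mu]_x (nsq (f x))%:E)%E.
Proof.
rewrite powR_Lnorm//; apply: eq_integral => x _ /=.
by rewrite nsqE powR_mulrn// real_normK// num_real.
Qed.

Lemma L2predP f : f \in L2pred mu <->
  cmeasurable f /\ (\int[mu]_x (nsq (f x))%:E < +oo)%E.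
Proof.
have h : finite_L2norm mu f <-> (\int[mu]_x (nsq (f x))%:E < +oo)%E.
  rewrite -Lnorm_nsq /finite_L2norm /finite_norm.
  have := Lnorm_ge0 mu 2%:E (EFin \o (fun x => normc (f x))).
  case: ('N[mu]_2%:E[_])%E => [r _|_|//]; last by rewrite poweRyr.
  by split=> _; exact: ltry.
by rewrite inE/=; split => -[? /h].
Qed.

Lemma L2_mem F : (F : X -> C) \in L2pred mu.
Proof. by rewrite /L2_repr; case: (repr F) => f. Qed.

Lemma L2_cmeasurable F : cmeasurable (F : X -> C).
Proof. by have /L2predP[] := L2_mem F. Qed.

Lemma L2_norm_sqr F : ((L2_norm F ^+ 2)%:E = \int[mu]_x (nsq (F x))%:E)%E.
Proof.
have := L2_mem F; rewrite inE/= => -[_]; rewrite /finite_L2norm /finite_norm.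
rewrite -Lnorm_nsq /L2_norm.
have := Lnorm_ge0 mu 2%:E (EFin \o (fun x => normc (F x))).
by case: ('N[mu]_2%:E[_])%E => [r||]//= r0 _; rewrite powR_mulrn.
Qed.

Lemma L2_norm_ge0 F : 0 <= L2_norm F.
Proof. by rewrite /L2_norm fine_ge0// Lnorm_ge0. Qed.

Lemma L2_integrable_nsq F : mu.-integrable setT (fun x => (nsq (F x))%:E).
Proof.
apply/integrableP; split.
  exact/measurable_EFinP/cmeasurable_nsq/L2_cmeasurable.
under eq_integral do rewrite gee0_abs ?lee_fin ?nsq_ge0//.
by rewrite -L2_norm_sqr ltry.
Qed.

Definition dotc z a : R := Re z * Re a + Im z * Im a.

Lemma L2_integrable_dotc F G :
  mu.-integrable setT (EFin \o (fun x => dotc (F x) (G x))).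
Proof.
have [mFr mFi] := L2_cmeasurable F; have [mGr mGi] := L2_cmeasurable G.
apply: (@le_integrable _ _ _ _ _ measurableT _
   ((fun x => (nsq (F x))%:E) \+ (fun x => (nsq (G x))%:E))%E).
- by apply/measurable_EFinP; apply: measurable_funD; exact: measurable_funM.
- move=> x _ /=; rewrite lee_fin (ger0_norm (addr_ge0 (nsq_ge0 _) (nsq_ge0 _))).
  rewrite /nsq /dotc; case: (F x) (G x) => a b [c e] /=.
  have := (sqr_ge0 a, sqr_ge0 b, sqr_ge0 c, sqr_ge0 e).
  move=> [[[]]]; have := (sqr_ge0 (a + c), sqr_ge0 (b + e)).
  move=> []; have := (sqr_ge0 (a - c), sqr_ge0 (b - e)) => -[].
  by rewrite !expr2 ler_norml => *; apply/andP; split; lra.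
- by apply: integrableD => //; exact: L2_integrable_nsq.
Qed.

(** The real part of the inner product determines it ([inner_rip]), and turns
    [L^2] into a real Hilbert space, where the inequalities below take place in
    an ordered field. *)
Definition rip F G : R := Re (inner F G).

Lemma ripE F G : rip F G = \int[mu]_x dotc (F x) (G x).
Proof.
rewrite /rip /inner /cintegral /=; apply: eq_Rintegral => x _.
by rewrite /dotc; case: (F x) (G x) => a b [c e] /=; rewrite mulrN opprK.
Qed.

Lemma cmeasurable_dotc f g : cmeasurable f -> cmeasurable g ->
  measurable_fun setT (fun x => dotc (f x) (g x)).
Proof.
by move=> [? ?] [? ?]; apply: measurable_funD; exact: measurable_funM.
Qed.

Lemma rip_ae F G f g : (F : X -> C) = f %[ae mu] -> (G : X -> C) = g %[ae mu] ->
  cmeasurable f -> cmeasurable g -> rip F G = \int[mu]_x dotc (f x) (g x).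
Proof.
move=> Ff Gg mf mg; rewrite ripE /Rintegral; congr fine.
apply: ae_eq_integral => //.
- exact/measurable_EFinP/cmeasurable_dotc/L2_cmeasurable/L2_cmeasurable.
- exact/measurable_EFinP/cmeasurable_dotc.
- by apply: filterS2 Ff Gg => x /= Ff Gg _; rewrite Ff// Gg.
Qed.

Lemma ripC F G : rip F G = rip G F.
Proof.
by rewrite !ripE; apply: eq_Rintegral => x _; rewrite /dotc mulrC (mulrC (Im _)).
Qed.

Lemma ripDl F G K : rip (F + G) K = rip F K + rip G K.
Proof.
have mFG := cmeasurableD (L2_cmeasurable F) (L2_cmeasurable G).
rewrite (rip_ae (L2_reprD F G) (ae_eq_refl _ _ _) mFG (L2_cmeasurable K)).
rewrite [X in _ = X + _]ripE [X in _ = _ + X]ripE -RintegralD//;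
  [|exact: L2_integrable_dotc..].
apply: eq_Rintegral => x _; rewrite /dotc.
by case: (F x) (G x) => a b [c e] /=; ring.
Qed.

Lemma cmeasurable_conj f : cmeasurable f -> cmeasurable (fun x => conjc (f x)).
Proof.
have cr : (fun x => Re (conjc (f x))) = (fun x => Re (f x)).
  by apply/funext => x; case: (f x).
have ci : (fun x => Im (conjc (f x))) = (fun x => - Im (f x)).
  by apply/funext => x; case: (f x).
by move=> [mr mi]; split; rewrite ?cr ?ci//; exact: measurableT_comp.
Qed.

Lemma normc_conj z : normc (conjc z) = normc z.
Proof. by case: z => a b; rewrite /normc /= sqrrN. Qed.

Lemma normc_ge0 z : 0 <= normc z.
Proof. by case: z => ? ?; exact: sqrtr_ge0. Qed.

Lemma normc_real_ge0 r : 0 <= r -> normc r%:C%C = r.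
Proof. by move=> r0; rewrite /normc /= expr0n /= addr0 sqrtr_sqr ger0_norm. Qed.

Lemma cmeasurable_cst z : cmeasurable (cst z : X -> C).
Proof. by split; exact: measurable_cst. Qed.

Lemma ripZl r F K : rip (r%:C%C *: F) K = r * rip F K.
Proof.
have mF := cmeasurableM (cmeasurable_cst r%:C%C) (L2_cmeasurable F).
rewrite (rip_ae (L2_reprZ _ F) (ae_eq_refl _ _ _) mF (L2_cmeasurable K)).
rewrite [X in _ = _ * X]ripE -RintegralZl//; last exact: L2_integrable_dotc.
apply: eq_Rintegral => x _; rewrite /dotc.
by case: (F x) => a b /=; ring.
Qed.

Lemma dotcMl z a b : dotc (z * a) b = dotc a (conjc z * b).
Proof. by rewrite /dotc; case: z a b => z1 z2 [a1 a2] [b1 b2] /=; ring. Qed.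

Lemma ripZc z F K : rip (z *: F) K = rip F (conjc z *: K).
Proof.
have mF := cmeasurableM (cmeasurable_cst z) (L2_cmeasurable F).
have mK := cmeasurableM (cmeasurable_cst (conjc z)) (L2_cmeasurable K).
rewrite (rip_ae (L2_reprZ _ F) (ae_eq_refl _ _ _) mF (L2_cmeasurable K)).
rewrite (rip_ae (ae_eq_refl _ _ _) (L2_reprZ _ K) (L2_cmeasurable F) mK).
by apply: eq_Rintegral => x _; rewrite dotcMl.
Qed.

Lemma ripxx F : rip F F = L2_norm F ^+ 2.
Proof.
rewrite ripE /Rintegral -[RHS]/(fine (L2_norm F ^+ 2)%:E) L2_norm_sqr.
by congr fine; apply: eq_integral => x _; rewrite /dotc /nsq !expr2.
Qed.

Lemma inner_rip F G : inner F G = (rip F G +i* rip F ('i%C *: G))%C.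
Proof.
apply/eqP; rewrite eq_complex eqxx /=; apply/eqP.
have mG := cmeasurableM (cmeasurable_cst 'i%C) (L2_cmeasurable G).
rewrite (rip_ae (ae_eq_refl _ _ _) (L2_reprZ _ G) (L2_cmeasurable F) mG).
by apply: eq_Rintegral => x _; rewrite /dotc; case: (F x) (G x) => a b [c e] /=; ring.
Qed.

Lemma L2_repr0 : L2_repr (0 : H) = (fun=> 0) %[ae mu].
Proof.
have -> : (0 : H) = L2_class (0 : L2fun mu).
  apply: (addrI (L2_class (0 : L2fun mu))).
  by rewrite addr0 -L2_classD addr0.
exact: L2_repr_class.
Qed.

Lemma L2_norm_eq0 F : L2_norm F = 0 -> F = 0.
Proof.
move=> F0; apply/L2_eqP.
have /ae_eq_integral_abs h : measurable_fun setT (fun x => (nsq (F x))%:E).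
  exact/measurable_EFinP/cmeasurable_nsq/L2_cmeasurable.
have : (\int[mu]_x `|(nsq (F x))%:E| = 0)%E.
  under eq_integral do rewrite gee0_abs ?lee_fin ?nsq_ge0//.
  by rewrite -L2_norm_sqr F0 expr0n.
move/(h _ measurableT).
have := L2_repr0.
apply: filterS2 => x /= h0 hF _; rewrite h0//.
by apply: nsq_eq0; have [] := hF I.
Qed.

Lemma ripDr F G K : rip F (G + K) = rip F G + rip F K.
Proof. by rewrite ripC ripDl !(ripC F). Qed.

Lemma ripZr r F K : rip F (r%:C%C *: K) = r * rip F K.
Proof. by rewrite ripC ripZl ripC. Qed.

Lemma ripNl F K : rip (- F) K = - rip F K.
Proof.
have -> : - F = (-1)%:C%C *: F by rewrite rmorphN1 scaleN1r.
by rewrite ripZl mulN1r.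
Qed.

Lemma ripNr F K : rip F (- K) = - rip F K.
Proof. by rewrite ripC ripNl ripC. Qed.

Lemma ripBl F G K : rip (F - G) K = rip F K - rip G K.
Proof. by rewrite ripDl ripNl. Qed.

Lemma ripBr F G K : rip F (G - K) = rip F G - rip F K.
Proof. by rewrite ripDr ripNr. Qed.

Lemma rip0l F : rip 0 F = 0.
Proof. by rewrite -(subrr 0) ripBl subrr. Qed.

Lemma rip0r F : rip F 0 = 0.
Proof. by rewrite ripC rip0l. Qed.

Lemma rip_eq0 F : rip F F = 0 -> F = 0.
Proof. by rewrite ripxx => /eqP; rewrite sqrf_eq0 => /eqP /L2_norm_eq0. Qed.

Lemma rip_ge0 F : 0 <= rip F F.
Proof. by rewrite ripxx sqr_ge0. Qed.

Lemma rip_inj F G : (forall K, rip F K = rip G K) -> F = G.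
Proof.
move=> h; apply/eqP; rewrite -subr_eq0; apply/eqP/rip_eq0.
by rewrite ripBl h subrr.
Qed.

Lemma normL2_0 : L2_norm (0 : H) = 0.
Proof. by apply/eqP; rewrite -sqrf_eq0 -ripxx rip0l. Qed.

Lemma normL2_le F r : 0 <= r -> (L2_norm F <= r) = (rip F F <= r ^+ 2).
Proof. by move=> r0; rewrite ripxx ler_pXn2r// nnegrE ?L2_norm_ge0. Qed.

(** Cauchy-Schwarz: the square of [|G| F - |F| G] is nonnegative. *)
Lemma rip_le F G : rip F G <= L2_norm F * L2_norm G.
Proof.
have [G0|G0] := eqVneq (L2_norm G) 0.
  by rewrite (L2_norm_eq0 G0) rip0r normL2_0 mulr0.
have G_gt0 : 0 < L2_norm G by rewrite lt_neqAle eq_sym G0 L2_norm_ge0.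
have := rip_ge0 ((L2_norm G)%:C%C *: F - (L2_norm F)%:C%C *: G).
rewrite ripBl !ripBr !ripZl !ripZr !ripxx (ripC G F).
have := L2_norm_ge0 F; rewrite le_eqVlt => /predU1P[/esym/L2_norm_eq0 -> _|F0].
  by rewrite rip0l normL2_0 mul0r.
set a := L2_norm F; set b := L2_norm G; rewrite -/a in F0; rewrite -/b in G_gt0.
move=> h; rewrite -(ler_pM2l (mulr_gt0 F0 G_gt0)).
by lra.
Qed.

Lemma normL2D F G : L2_norm (F + G) <= L2_norm F + L2_norm G.
Proof.
rewrite normL2_le ?addr_ge0 ?L2_norm_ge0// ripDl !ripDr !ripxx (ripC G F).
by have := rip_le F G; lra.
Qed.

Lemma normL2N F : L2_norm (- F) = L2_norm F.
Proof.
apply/eqP; rewrite -(eqrXn2 (n := 2)) ?L2_norm_ge0//.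
by rewrite -!ripxx ripNl ripNr opprK.
Qed.

Lemma normL2B F G : L2_norm (F - G) <= L2_norm F + L2_norm G.
Proof. by rewrite (le_trans (normL2D _ _))// normL2N. Qed.

Lemma normL2_distC F G : L2_norm (F - G) = L2_norm (G - F).
Proof. by rewrite -normL2N opprB. Qed.

Lemma normL2_tri F G K : L2_norm (F - K) <= L2_norm (F - G) + L2_norm (G - K).
Proof. by rewrite (le_trans _ (normL2D _ _))// addrA subrK. Qed.

Lemma normL2Z z F : L2_norm (z *: F) = normc z * L2_norm F.
Proof.
apply/eqP; rewrite -(eqrXn2 (n := 2)) ?mulr_ge0 ?L2_norm_ge0//; last first.
  exact: normc_ge0.
rewrite exprMn -!ripxx ripZc scalerA -nsqE.
have -> : conjc z * z = (nsq z)%:C%C.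
  case: z => a b; rewrite /nsq; apply/eqP; rewrite eq_complex /=.
  by apply/andP; split; apply/eqP; ring.
by rewrite ripZr.
Qed.

Lemma ler_norm_rip F G : `|rip F G| <= L2_norm F * L2_norm G.
Proof.
by rewrite ler_norml rip_le andbT lerNl -ripNl -(normL2N F) rip_le.
Qed.

End L2_inner_product.

(** * Completeness of [L^2] *)

Lemma le_geometric0 (R : realType) (a c k : R) : 0 <= k < 1 ->
  (forall n, a <= c * k ^+ n) -> a <= 0.
Proof.
move=> /andP[k0 k1] h; have : (fun n => c * k ^+ n) @ \oo --> (0 : R).
  rewrite -(mulr0 c); apply: cvgM; first exact: cvg_cst.
  by apply: cvg_expr; rewrite ger0_norm.
move=> hc; rewrite -(cvg_lim _ hc)//; apply: limr_ge.
  by apply/cvg_ex; exists 0.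
by apply: nearW => n; exact: h.
Qed.

Lemma cvg_geometric_increments (R : realType) (u : nat -> R) (M q : R) :
  0 <= q < 1 -> (forall n, `|u n.+1 - u n| <= M * q ^+ n) -> cvgn u.
Proof.
move=> /andP[q0 q1] h.
have -> : u = (fun n => u 0%N + series (telescope u) n).
  by apply/funext => n; exact: eq_sum_telescope.
apply: is_cvgD; first exact: is_cvg_cst.
apply: normed_cvg; apply: (@series_le_cvg _ _ (geometric M q)) => //.
- by move=> n; exact: normr_ge0.
- by move=> n; exact: (le_trans (normr_ge0 _) (h n)).
- by apply: is_cvg_geometric_series; rewrite ger0_norm.
Qed.

Section L2_complete.
Context d (X : measurableType d) (R : realType).
Variable mu : {measure set X -> \bar R}.
Local Notation C := R[i].
Local Notation H := (L2 mu).
Implicit Types (F G K : H) (f g : X -> C) (z a : C) (r s : R).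

(** The default [0] makes this total: it is meant for square integrable [f]. *)
Definition toL2 f : H := L2_class (insubd (0 : L2fun mu) f).

Lemma toL2E f : f \in L2pred mu -> (toL2 f : X -> C) = f %[ae mu].
Proof.
move=> hf; have := L2_repr_class (insubd (0 : L2fun mu) f).
by rewrite -[X in _ -> _ = X %[ae mu]](insubdK (0 : L2fun mu) hf).
Qed.

Lemma L2_norm_ae F f : (F : X -> C) = f %[ae mu] -> cmeasurable f ->
  ((L2_norm F ^+ 2)%:E = \int[mu]_x (nsq (f x))%:E)%E.
Proof.
move=> Ff mf; rewrite L2_norm_sqr; apply: ae_eq_integral => //.
- exact/measurable_EFinP/cmeasurable_nsq/L2_cmeasurable.
- exact/measurable_EFinP/cmeasurable_nsq.
- by apply: filterS Ff => x /= h _; rewrite h.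
Qed.

Lemma L2_reprB F G :
  ((F - G : H) : X -> C) = (fun x => F x - G x) %[ae mu].
Proof.
apply: filterS2 (L2_reprD F (- G)) (L2_reprZ (-1) G) => x /= h1 h2 _.
by rewrite h1// -[in L2_repr (- G)]scaleN1r h2// mulN1r.
Qed.

Lemma cmeasurableN f : cmeasurable f -> cmeasurable (fun x => - f x).
Proof.
move=> mf; rewrite (_ : (fun x => - f x) = (fun x => cst (-1) x * f x)).
  by apply: cmeasurableM => //; exact: cmeasurable_cst.
by apply/funext => x; rewrite mulN1r.
Qed.

Lemma cmeasurableB f g : cmeasurable f -> cmeasurable g ->
  cmeasurable (fun x => f x - g x).
Proof. by move=> mf mg; apply: cmeasurableD => //; exact: cmeasurableN. Qed.

Lemma geometric_dist (u : nat -> H) (c k : R) : 0 <= k < 1 ->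
  (forall n, L2_norm (u n.+1 - u n) <= c * k ^+ n) ->
  forall n m, (n <= m)%N -> L2_norm (u m - u n) <= c * k ^+ n / (1 - k).
Proof.
move=> /andP[k0 k1] h n m /subnK <-; set j := (m - n)%N.
have k1' : 0 < 1 - k by rewrite subr_gt0.
have c0 : 0 <= c by have := h 0%N; rewrite expr0 mulr1; apply: le_trans; exact: L2_norm_ge0.
suff : L2_norm (u (j + n)%N - u n) <= c * k ^+ n * (1 - k ^+ j) / (1 - k).
  move/le_trans; apply; rewrite ler_pM2r ?invr_gt0// ler_piMr//.
    by rewrite mulr_ge0 ?exprn_ge0.
  by rewrite lerBlDr lerDl exprn_ge0.
elim: j => [|j ih].
  by rewrite add0n subrr normL2_0 expr0 subrr mulr0 mul0r.
rewrite addSn (le_trans (normL2_tri _ (u (j + n)%N) _))//.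
apply: (le_trans (lerD (h _) ih)); rewrite le_eqVlt; apply/orP; left; apply/eqP.
by rewrite exprS exprD; field; rewrite gt_eqF.
Qed.

(** Riesz-Fischer, for sequences with geometric increments: these are all that
    iterations and minimizing sequences produce, and they come with an explicit
    rate.  On the set where [\sum_n |u (n+1) - u n|^2 / k ^ n]
    converges, which is conull, the increments are geometrically small, so
    [u n] converges pointwise; Fatou's lemma then gives the distance to the
    limit. *)
Lemma L2_complete (u : nat -> H) (c k : R) : 0 < k < 1 ->
  (forall n, L2_norm (u n.+1 - u n) <= c * k ^+ n) ->
  exists F, forall n, L2_norm (u n - F) <= c * k ^+ n / (1 - k).
Proof.
move=> /andP[k0 k1] hu.
have k01 : 0 <= k < 1 by rewrite ltW.
have k1' : 0 < 1 - k by rewrite subr_gt0.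
have c0 : 0 <= c by have := hu 0%N; rewrite expr0 mulr1; apply: le_trans; exact: L2_norm_ge0.
pose g n x : \bar R := (nsq (u n.+1 x - u n x) / k ^+ n)%:E.
have g0 n x : (0 <= g n x)%E.
  by rewrite lee_fin divr_ge0 ?nsq_ge0 ?exprn_ge0// ltW.
have mdiff n m : cmeasurable (fun x => u n x - u m x).
  by apply: cmeasurableB; exact: L2_cmeasurable.
have mg n : measurable_fun setT (g n).
  by apply/measurable_EFinP/measurable_funM => //; exact: cmeasurable_nsq.
pose S x := (\sum_(0 <= n <oo) g n x)%E.
have mS : measurable_fun setT S by exact: ge0_emeasurable_sum.
have S0 x : (0 <= S x)%E by exact: nneseries_ge0.
have intS : (\int[mu]_x S x < +oo)%E.
  rewrite integral_nneseries//.
  apply: (@le_lt_trans _ _ (\sum_(0 <= n <oo) (c ^+ 2 * k ^+ n)%:E)%E).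
    apply: lee_nneseries => n * ; first by apply: integral_ge0 => x _; exact: g0.
    rewrite /g; under eq_integral do rewrite mulrC EFinM.
    rewrite ge0_integralZl_EFin//.
    - rewrite -(L2_norm_ae (L2_reprB (u n.+1) (u n)))// -EFinM lee_fin.
      rewrite mulrC ler_pdivrMr ?exprn_gt0//.
      have -> : c ^+ 2 * k ^+ n * k ^+ n = (c * k ^+ n) ^+ 2 by ring.
      by rewrite ler_pXn2r ?nnegrE ?L2_norm_ge0 ?mulr_ge0 ?exprn_ge0// ltW.
    - by move=> x _; rewrite lee_fin nsq_ge0.
    - exact/measurable_EFinP/cmeasurable_nsq.
    - by rewrite invr_ge0 exprn_ge0// ltW.
  have hl : (fun n => (\sum_(0 <= i < n) (c ^+ 2 * k ^+ i)%:E)%E) @ \oo -->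
      (c ^+ 2 / (1 - k))%:E.
    rewrite (_ : (fun n => _) = EFin \o series (geometric (c ^+ 2) k)).
      apply: cvg_comp; first by apply: cvg_geometric_series; rewrite ger0_norm// ltW.
      exact: cvg_refl.
    by apply/funext => n /=; rewrite sumEFin.
  by rewrite (cvg_lim _ hl)// ltry.
pose D := [set x | (S x < +oo)%E].
have mD : measurable D.
  by rewrite -[D]setTI; exact: emeasurable_fun_infty_o.
have aeD : \forall x \ae mu, D x.
  have /integrable_ae : mu.-integrable setT S.
    apply/integrableP; split => //.
    by under eq_integral do rewrite gee0_abs//.
  by move/(_ measurableT); apply: filterS => x /(_ I) hx; rewrite /D /= ltey_eq hx.
have incr x : D x -> forall n,
    nsq (u n.+1 x - u n x) <= fine (S x) * k ^+ n.
  move=> Dx n; have Sx : S x \is a fin_num by rewrite ge0_fin_numE.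
  rewrite -ler_pdivrMr ?exprn_gt0// -lee_fin fineK// -/(g n x).
  have := @nneseries_lim_ge _ (g ^~ x) xpredT 0%N n.+1 (fun i _ _ => g0 i x).
  by apply: le_trans; rewrite big_nat_recr//= leeDr// sume_ge0.
pose q := Num.sqrt k.
have q01 : 0 <= q < 1.
  by rewrite sqrtr_ge0/= -(sqrtr1 R) ltr_sqrt.
have sqrt_incr x n : D x -> Num.sqrt (fine (S x) * k ^+ n) = Num.sqrt (fine (S x)) * q ^+ n.
  move=> Dx; rewrite sqrtrM ?fine_ge0//; congr (_ * _).
  rewrite -[k in LHS](sqr_sqrtr (ltW k0)) -exprM mulnC exprM sqrtr_sqr ger0_norm//.
have abs_nsq (a b r : R) : a ^+ 2 + b ^+ 2 <= r -> `|a| <= Num.sqrt r /\ `|b| <= Num.sqrt r.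
  move=> h; have r0 : 0 <= r by rewrite (le_trans _ h)// addr_ge0 ?sqr_ge0.
  split; [rewrite -(sqrtr_sqr a)|rewrite -(sqrtr_sqr b)];
    rewrite ler_sqrt//; apply: le_trans h; by rewrite ?lerDl ?lerDr sqr_ge0.
pose v n x : C := if x \in D then u n x else 0.
have cvRe x : cvgn (fun n => Re (v n x)).
  rewrite /v; have [xD|xD] := boolP (x \in D); last exact: is_cvg_cst.
  have Dx : D x by rewrite inE in xD.
  apply: (@cvg_geometric_increments _ _ (Num.sqrt (fine (S x))) q) => // n.
  have [+ _] := abs_nsq _ _ _ (incr x Dx n); rewrite sqrt_incr//.
  by case: (u n.+1 x) (u n x) => ? ? [].
have cvIm x : cvgn (fun n => Im (v n x)).
  rewrite /v; have [xD|xD] := boolP (x \in D); last exact: is_cvg_cst.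
  have Dx : D x by rewrite inE in xD.
  apply: (@cvg_geometric_increments _ _ (Num.sqrt (fine (S x))) q) => // n.
  have [_] := abs_nsq _ _ _ (incr x Dx n); rewrite sqrt_incr//.
  by case: (u n.+1 x) (u n x) => ? ? [].
pose f x : C := (limn (fun n => Re (v n x)) +i* limn (fun n => Im (v n x)))%C.
have mv n : cmeasurable (v n).
  have [mr mi] := L2_cmeasurable (u n).
  have mD1 : measurable_fun setT (\1_D : X -> R) by exact: measurable_indic.
  split.
    rewrite (_ : (fun x => _) = (\1_D \* (fun x => Re (u n x)))).
      exact: measurable_funM.
    by apply/funext => x; rewrite /v /= indicE; case: ifP; rewrite ?mul1r ?mul0r.
  rewrite (_ : (fun x => _) = (\1_D \* (fun x => Im (u n x)))).
    exact: measurable_funM.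
  by apply/funext => x; rewrite /v /= indicE; case: ifP; rewrite ?mul1r ?mul0r.
have mf : cmeasurable f.
  split.
    by apply: (measurable_fun_cvg (h := fun n x => Re (v n x))) => [n|x _];
      [have [] := mv n|exact: cvRe].
  by apply: (measurable_fun_cvg (h := fun n x => Im (v n x))) => [n|x _];
      [have [] := mv n|exact: cvIm].
have uv n : (u n : X -> C) = v n %[ae mu].
  by apply: filterS aeD => x Dx _; rewrite /v mem_set.
have bound n : (\int[mu]_x (nsq (v n x - f x))%:E <= ((c * k ^+ n / (1 - k)) ^+ 2)%:E)%E.
  pose h m x := (nsq (v n x - v m x))%:E.
  have hlim x : limn_einf (h ^~ x) = (nsq (v n x - f x))%:E.
    have hc : (fun m => (Re (v n x) - Re (v m x)) ^+ 2 + (Im (v n x) - Im (v m x)) ^+ 2)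
        @ \oo --> (Re (v n x) - Re (f x)) ^+ 2 + (Im (v n x) - Im (f x)) ^+ 2.
      apply: cvgD.
        have cR : (fun m => Re (v n x) - Re (v m x)) @ \oo --> Re (v n x) - Re (f x).
          by apply: cvgB; [exact: cvg_cst|exact: cvRe].
        by under eq_fun do rewrite expr2; rewrite expr2; exact: cvgM.
      have cI : (fun m => Im (v n x) - Im (v m x)) @ \oo --> Im (v n x) - Im (f x).
        by apply: cvgB; [exact: cvg_cst|exact: cvIm].
      by under eq_fun do rewrite expr2; rewrite expr2; exact: cvgM.
    have hE : h ^~ x = EFin \o (fun m => (Re (v n x) - Re (v m x)) ^+ 2 +
        (Im (v n x) - Im (v m x)) ^+ 2).
      by apply/funext => m; rewrite /h /nsq /=; case: (v n x) (v m x) => ? ? [].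
    have [] // := @cvg_limn_einf_sup _ (h ^~ x) (nsq (v n x - f x))%:E.
    rewrite hE; apply: cvg_EFin; first exact: nearW.
    rewrite (_ : nsq _ = (Re (v n x) - Re (f x)) ^+ 2 + (Im (v n x) - Im (f x)) ^+ 2)//.
    by rewrite /nsq; case: (v n x).
  have -> : (\int[mu]_x (nsq (v n x - f x))%:E = \int[mu]_x limn_einf (h ^~ x))%E.
    by apply: eq_integral => x _; rewrite hlim.
  apply: (le_trans (fatou _ _ _ _)) => //.
  - by move=> m; apply/measurable_EFinP/cmeasurable_nsq; exact: cmeasurableB.
  - by move=> m x _; rewrite lee_fin nsq_ge0.
  rewrite limn_einf_lim; apply: lime_le; first exact: is_cvg_einfs.
  apply: nearW => N; apply: ereal_inf_le.
  exists (\int[mu]_x h (maxn n N) x)%E; first by exists (maxn n N) => //=; exact: leq_maxr.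
  rewrite /h -(L2_norm_ae (F := u n - u (maxn n N))).
  - rewrite lee_fin ler_pXn2r ?nnegrE ?L2_norm_ge0//.
      by rewrite normL2_distC (geometric_dist k01 hu)// leq_maxl.
    by rewrite divr_ge0 ?mulr_ge0 ?exprn_ge0 ?(ltW k0) ?(ltW k1').
  - apply: filterS3 (L2_reprB (u n) (u (maxn n N))) (uv n) (uv (maxn n N)) => x /=.
    by move=> h1 h2 h3 _; rewrite h1// h2// h3.
  - exact: cmeasurableB.
have memvf n : (fun x => v n x - f x) \in L2pred mu.
  apply/L2predP; split; first exact: cmeasurableB.
  by rewrite (le_lt_trans (bound n))// ltry.
pose F : H := u 0%N - toL2 (fun x => v 0%N x - f x).
have aeF : (F : X -> C) = f %[ae mu].
  apply: filterS3 (L2_reprB (u 0%N) (toL2 (fun x => v 0%N x - f x)))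
    (toL2E (memvf 0%N)) (uv 0%N) => x h1 h2 h3 _.
  by rewrite h1// h2// h3// opprB addrCA subrr addr0.
exists F => n.
have aeB : ((u n - F : H) : X -> C) = (fun x => v n x - f x) %[ae mu].
  apply: filterS3 (L2_reprB (u n) F) aeF (uv n) => x h1 h2 h3 _.
  by rewrite h1// h2// h3.
rewrite -(ler_pXn2r (n := 2))// ?nnegrE ?L2_norm_ge0//.
  by rewrite -lee_fin (L2_norm_ae aeB)//; exact: cmeasurableB.
by rewrite divr_ge0 ?mulr_ge0 ?exprn_ge0 ?(ltW k0) ?(ltW k1').
Qed.

End L2_complete.

(** * Adjoints, inverses and spectra of bounded operators *)

Section L2_operators.
Context d (X : measurableType d) (R : realType).
Variable mu : {measure set X -> \bar R}.
Local Notation C := R[i].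
Local Notation H := (L2 mu).
Implicit Types (F G K : H) (S B N : H -> H) (z a : C) (r s : R).

Lemma linear_opD S : linear S -> {morph S : F G / F + G}.
Proof. by move=> lS F G; rewrite -[F in LHS]scale1r lS scale1r. Qed.

Lemma linear_op0 S : linear S -> S 0 = 0.
Proof. by move=> lS; apply: (addrI (S 0)); rewrite -linear_opD// !addr0. Qed.

Lemma linear_opZ S : linear S -> forall z F, S (z *: F) = z *: S F.
Proof. by move=> lS z F; rewrite -[z *: F]addr0 lS linear_op0// addr0. Qed.

Lemma linear_opN S : linear S -> {morph S : F / - F}.
Proof. by move=> lS F; rewrite -scaleN1r linear_opZ// scaleN1r. Qed.

Lemma linear_opB S : linear S -> {morph S : F G / F - G}.
Proof. by move=> lS F G; rewrite linear_opD// linear_opN. Qed.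

Lemma bounded_operator_bound S : bounded_operator S ->
  exists2 M, 0 < M & forall F, L2_norm (S F) <= M * L2_norm F.
Proof.
move=> [_ [M hM]]; exists (`|M| + 1); first by rewrite ltr_wpDl.
move=> F; apply: (le_trans (hM F)); rewrite ler_wpM2r ?L2_norm_ge0//.
by rewrite (le_trans (ler_norm _))// lerDl.
Qed.

Lemma bounded_operator_comp S B :
  bounded_operator S -> bounded_operator B -> bounded_operator (S \o B).
Proof.
move=> bS bB; have [[lS _] [lB _]] := (bS, bB); split=> [z F G /=|].
  by rewrite lB lS.
have [M M0 hM] := bounded_operator_bound bS.
have [M' M'0 hM'] := bounded_operator_bound bB.
exists (M * M') => F /=; apply: (le_trans (hM _)).
by rewrite -mulrA ler_wpM2l// ltW.
Qed.

Lemma bounded_operator_axpy z S B :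
  bounded_operator S -> bounded_operator B ->
  bounded_operator (fun F => z *: S F + B F).
Proof.
move=> bS bB; have [[lS _] [lB _]] := (bS, bB); split=> [a F G /=|].
  rewrite lB lS !scalerDr !scalerA (mulrC z) -!addrA; congr (_ + _).
  by rewrite addrCA.
have [M M0 hM] := bounded_operator_bound bS.
have [M' M'0 hM'] := bounded_operator_bound bB.
exists (normc z * M + M') => F /=; apply: (le_trans (normL2D _ _)).
rewrite mulrDl lerD// normL2Z -mulrA ler_wpM2l//.
by exact: normc_ge0.
Qed.

Lemma bounded_operator_id : bounded_operator (id : H -> H).
Proof. by split=> //; exists 1 => F; rewrite mul1r. Qed.

Lemma bounded_operatorZ z S :
  bounded_operator S -> bounded_operator (fun F => z *: S F).
Proof.
move=> bS; have [lS _] := bS; split=> [a F G|].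
  by rewrite lS scalerDr !scalerA mulrC.
have [M M0 hM] := bounded_operator_bound bS.
exists (normc z * M) => F; rewrite normL2Z -mulrA ler_wpM2l//.
by exact: normc_ge0.
Qed.

Lemma adjoint_rip S S' : is_adjoint S S' ->
  forall F G, rip (S F) G = rip F (S' G).
Proof. by move=> [_ h] F G; rewrite /rip h. Qed.

Lemma rip_adjoint S S' : bounded_operator S' ->
  (forall F G, rip (S F) G = rip F (S' G)) -> is_adjoint S S'.
Proof.
move=> bS' h; split=> // F G; rewrite !inner_rip !h.
by rewrite (linear_opZ bS'.1).
Qed.

(** Riesz: the quadratic functional [F |-> |F|^2 - 2 l(F)] is bounded below, and
    by the parallelogram law its minimizing sequences converge; the limit
    represents [l]. *)
Lemma riesz_rip (l : H -> R) (K : R) : {morph l : F G / F + G} ->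
  (forall r F, l (r%:C%C *: F) = r * l F) -> (forall F, `|l F| <= K * L2_norm F) ->
  exists Y, forall F, l F = rip F Y.
Proof.
move=> lD lZ lK.
pose J F := rip F F - 2 * l F.
have Jge F : - K ^+ 2 <= J F.
  rewrite /J ripxx; have /ler_normlP[_] := lK F.
  by have := sqr_ge0 (L2_norm F - K); rewrite !expr2; lra.
pose E : set R := range J.
have infE : has_inf E.
  split; first by exists (J 0), 0.
  by exists (- K ^+ 2) => _ [F _ <-].
pose m := inf E.
have Jm F : m <= J F by apply: ge_inf; [exact: infE.2|exists F].
have p4 n : 0 < (4^-1 : R) ^+ n by rewrite exprn_gt0// invr_gt0.
have ex n : exists F, J F < m + 4^-1 ^+ n.
  have [_ [F _ <-] hF] := @inf_adherent _ E (4^-1 ^+ n) (p4 n) infE.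
  by exists F.
have [u hu] := choice ex.
have four n : (4^-1 : R) ^+ n = (2^-1 ^+ n) ^+ 2.
  by rewrite -exprM mulnC exprM; congr (_ ^+ _); lra.
have incr n : L2_norm (u n.+1 - u n) <= 2 * 2^-1 ^+ n.
  rewrite normL2_le ?mulr_ge0 ?exprn_ge0 ?invr_ge0//.
  have := Jm ((2^-1)%:C%C *: (u n.+1 + u n)).
  have := hu n.+1; have := hu n; rewrite /J !ripZl !ripZr lZ lD.
  rewrite !(ripBl, ripBr, ripDl, ripDr) (ripC (u n.+1) (u n)).
  have h4 : (4^-1 : R) ^+ n.+1 <= 4^-1 ^+ n.
    by rewrite exprS ler_piMl ?exprn_ge0 ?invr_ge0// invf_le1// ler1n.
  rewrite exprMn -four; move: h4; set p := _ ^+ n.+1; set q := _ ^+ n. lra.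
have half : 0 < (2^-1 : R) < 1 by apply/andP; split; lra.
have [Y hY] := L2_complete half incr.
exists Y => F; apply/eqP; rewrite -subr_eq0 -normr_le0.
pose a := rip F F + 1.
have a1 : 1 <= a by rewrite lerDr rip_ge0.
apply: (@le_geometric0 _ _ (a + 4 * L2_norm F) (2^-1)) => [|n].
  by apply/andP; split; lra.
pose D := rip F (u n) - l F.
have hD : `|D| <= a * 2^-1 ^+ n.
  have aq0 : 0 <= a * 2^-1 ^+ n by rewrite mulr_ge0 ?exprn_ge0 ?invr_ge0 ?(le_trans _ a1).
  rewrite -(ler_pXn2r (n := 2))// ?nnegrE// real_normK ?num_real//.
  have := Jm (u n + (- (D / a))%:C%C *: F).
  have := hu n; rewrite /J lD lZ !(ripDl, ripDr) !(ripZl, ripZr) (ripC (u n) F).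
  rewrite exprMn -four; set p := _ ^+ n => h1 h2.
  have p0 : 0 <= p by rewrite exprn_ge0 ?invr_ge0.
  have a_gt0 : 0 < a by rewrite (lt_le_trans _ a1).
  have : D ^+ 2 / a <= p.
    have -> : D ^+ 2 / a = 2 * (D / a) * D - (D / a) ^+ 2 * a.
      by field; rewrite gt_eqF.
    move: h1 h2; rewrite /D /a.
    set dd := _ / _; set x := rip F (u n); set y := rip F F; set z := l F.
    by have := sqr_ge0 dd; rewrite !expr2; nra.
  rewrite ler_pdivrMr// => h; apply: (le_trans h).
  by rewrite mulrC ler_wpM2r// expr2 ler_peMl// ltW.
have -> : l F - rip F Y = (rip F (u n - Y)) - D by rewrite /D ripBr; ring.
apply: (le_trans (ler_normB _ _)); rewrite addrC mulrDl lerD//.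
apply: (le_trans (ler_norm_rip _ _)).
rewrite (_ : 4 * _ * _ = L2_norm F * (2 * 2^-1 ^+ n / (1 - 2^-1))).
  by rewrite ler_wpM2l ?L2_norm_ge0.
by set p := _ ^+ n; field; rewrite ?pnatr_eq0.
Qed.

Lemma adjoint_exists N : bounded_operator N -> exists N', is_adjoint N N'.
Proof.
move=> bN; have [lN _] := bN; have [K K0 hK] := bounded_operator_bound bN.
have ex G : exists Y, forall F, rip (N F) G = rip F Y.
  apply: (@riesz_rip (fun F => rip (N F) G) (K * L2_norm G)) => [F F'|r F|F].
  - by rewrite linear_opD// ripDl.
  - by rewrite linear_opZ// ripZl.
  - by rewrite mulrAC (le_trans (ler_norm_rip _ _))// ler_wpM2r ?L2_norm_ge0.
have [N' hN'] := choice ex; exists N'; apply: rip_adjoint; last by move=> F G; exact: hN'.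
split=> [a F G|].
  apply: rip_inj => Y; rewrite ripC -hN' ripDr ripDl; congr (_ + _).
    by rewrite ripC ripZc -linear_opZ// ripC hN' ripC -ripZc.
  by rewrite hN' ripC.
exists K => G; have [N'G0|N'G0] := eqVneq (L2_norm (N' G)) 0.
  by rewrite N'G0 mulr_ge0 ?L2_norm_ge0// ltW.
have N'G_gt0 : 0 < L2_norm (N' G) by rewrite lt_neqAle eq_sym N'G0 L2_norm_ge0.
rewrite -(ler_pM2l N'G_gt0) -expr2 -ripxx -hN' (le_trans (rip_le _ _))//.
by rewrite mulrA (mulrC _ K) ler_wpM2r ?L2_norm_ge0.
Qed.

(** Lax-Milgram, by Banach iteration of [F |-> F - tau (B F - h)], which is a
    contraction for small [tau]. *)
Lemma coercive_inverse B (c : R) : bounded_operator B -> 0 < c ->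
  (forall F, c * rip F F <= rip (B F) F) ->
  exists2 B', bounded_operator B' & forall F, B (B' F) = F /\ B' (B F) = F.
Proof.
move=> bB c0 hc; have [lB _] := bB; have [K0 K0_gt0 hK0] := bounded_operator_bound bB.
(* [c] is added to make [c / K < 1], so that the contraction factor is positive *)
pose K := K0 + c.
have K_gt0 : 0 < K by rewrite addr_gt0.
have hK F : L2_norm (B F) <= K * L2_norm F.
  by rewrite (le_trans (hK0 F))// ler_wpM2r ?L2_norm_ge0// lerDl ltW.
(* this minimizes the bound [1 - 2 tau c + tau^2 K^2] on the
   square of the contraction factor *)
pose tau := c / K ^+ 2.
have tau_gt0 : 0 < tau by rewrite divr_gt0// exprn_gt0.
pose e := (c / K) ^+ 2.
have cK : 0 < c / K < 1.
  by rewrite divr_gt0//= ltr_pdivrMr// mul1r ltrDr.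
have e01 : 0 < e < 1.
  case/andP: cK => cK0 cK1; rewrite exprn_gt0//= exprn_ilt1//.
  exact: ltW.
pose k := Num.sqrt (1 - e).
have k01 : 0 < k < 1.
  case/andP: e01 => e0 e1.
  by rewrite sqrtr_gt0 subr_gt0 e1/= -[ltRHS]sqrtr1 ltr_sqrt// gtrBl.
have contr F : L2_norm (F - tau%:C%C *: B F) <= k * L2_norm F.
  have k0 : 0 <= k by case/andP: k01 => /ltW.
  rewrite normL2_le ?mulr_ge0 ?L2_norm_ge0// exprMn sqr_sqrtr; last first.
    by case/andP: e01 => _ /ltW; rewrite subr_ge0.
  rewrite !(ripBl, ripBr) !(ripZl, ripZr) -ripxx (ripC F (B F)).
  have h1 := hc F.
  have h2 : rip (B F) (B F) <= K ^+ 2 * rip F F.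
    by rewrite !ripxx -exprMn ler_pXn2r ?nnegrE ?mulr_ge0 ?L2_norm_ge0// ltW.
  have h3 : tau ^+ 2 * rip (B F) (B F) <= e * rip F F.
    rewrite (_ : e * _ = tau ^+ 2 * (K ^+ 2 * rip F F)).
      by rewrite ler_wpM2l// sqr_ge0.
    by rewrite /e /tau; field; rewrite gt_eqF.
  have h4 : e * rip F F <= tau * rip (B F) F.
    rewrite (_ : e * _ = tau * (c * rip F F)).
      by rewrite ler_wpM2l// ltW.
    by rewrite /e /tau; field; rewrite gt_eqF.
  by move: h3 h4; rewrite expr2 -mulrA; set p := tau * _; lra.
have onto h : exists F, B F = h.
  pose step F := F - tau%:C%C *: (B F - h).
  have stepB F G : step F - step G = (F - G) - tau%:C%C *: B (F - G).
    rewrite /step (linear_opB lB) opprD addrACA -opprD; congr (_ - _).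
    by rewrite -scalerBr opprB addrA subrK.
  pose u n := iter n step 0.
  pose c1 := L2_norm (u 1%N - u 0%N).
  have incr n : L2_norm (u n.+1 - u n) <= c1 * k ^+ n.
    elim: n => [|n ih]; first by rewrite expr0 mulr1.
    rewrite [u n.+2]/(step (u n.+1)) [in X in _ - X](_ : u n.+1 = step (u n))// stepB.
    rewrite (le_trans (contr _))// exprS mulrCA ler_wpM2l//.
    by case/andP: k01 => /ltW.
  have [F hF] := L2_complete k01 incr.
  exists F; apply/eqP; rewrite -subr_eq0; apply/eqP/L2_norm_eq0.
  apply/eqP; rewrite eq_le L2_norm_ge0 andbT.
  apply: (@le_geometric0 _ _ (K * (c1 / (1 - k)) + tau^-1 * c1) k).
    by case/andP: k01 => /ltW -> ->.
  move=> n; rewrite -(subrK (B (u n)) (B F)) -addrA -(linear_opB lB).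
  rewrite (le_trans (normL2D _ _))// mulrDl lerD//.
    rewrite (le_trans (hK _))// -mulrA ler_wpM2l ?(ltW K_gt0)//.
    by rewrite normL2_distC mulrAC.
  have -> : B (u n) - h = (tau^-1)%:C%C *: (u n - u n.+1).
    rewrite [u n.+1]/(step (u n)) /step opprB [u n + _]addrC subrK scalerA.
    by rewrite -rmorphM /= mulVf ?gt_eqF// scale1r.
  rewrite normL2Z normc_real_ge0 ?invr_ge0 ?(ltW tau_gt0)// normL2_distC -mulrA ler_wpM2l//.
  by rewrite invr_ge0 ltW.
have [B' hB'] := choice onto.
have inj F : B F = 0 -> F = 0.
  move=> BF0; apply: rip_eq0; apply/eqP; rewrite eq_le rip_ge0 andbT.
  by have := hc F; rewrite BF0 rip0l pmulr_rle0.
have injB F G : B F = B G -> F = G.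
  by move=> h; apply/eqP; rewrite -subr_eq0; apply/eqP/inj; rewrite (linear_opB lB) h subrr.
exists B'; last by move=> F; split=> //; apply: injB; rewrite hB'.
split=> [a F G|]; first by apply: injB; rewrite lB !hB'.
exists c^-1 => F; rewrite mulrC ler_pdivlMr//.
have [F0|F0] := eqVneq (L2_norm (B' F)) 0; first by rewrite F0 mul0r L2_norm_ge0.
have F_gt0 : 0 < L2_norm (B' F) by rewrite lt_neqAle eq_sym F0 L2_norm_ge0.
rewrite -(ler_pM2r F_gt0) (le_trans _ (rip_le _ _))// -[X in rip X]hB'.
by rewrite (le_trans _ (hc _))// ripxx expr2 mulrAC mulrC.
Qed.

Lemma rip_iskew F G : rip ('i%C *: F) G = - rip F ('i%C *: G).
Proof.
have ci : conjc 'i%C = - 'i%C :> C by apply/eqP; rewrite eq_complex /= oppr0 !eqxx.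
by rewrite ripZc ci scaleNr ripNr.
Qed.

Lemma rip_i F : rip ('i%C *: F) F = 0.
Proof. by have := rip_iskew F F; rewrite (ripC F); lra. Qed.

(** The hypothesis says that the inner product of [F] and [G] is real. *)
Lemma ripZ_diag z F G : rip ('i%C *: F) G = 0 -> rip (z *: F) G = Re z * rip F G.
Proof.
move=> h; rewrite [z in LHS]complexE scalerDl ripDl ripZl (mulrC 'i%C) -scalerA ripZl h.
by rewrite mulr0 addr0.
Qed.

(** For complex-linear [S] the real part of the inner product is enough. *)
Definition selfadjoint_op S := forall F G, rip (S F) G = rip F (S G).

(** If [z] is off the segment [[0, M]], then after rotation by a unit [a] among
    [1], [-1], [i], [-i], the operator [a (S - z)] is coercive, hence
    invertible. *)
Lemma positive_spectrum S (M : R) : bounded_operator S -> selfadjoint_op S ->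
  (forall F, 0 <= rip (S F) F) -> (forall F, L2_norm (S F) <= M * L2_norm F) ->
  forall z, spectrum S z -> Im z = 0 /\ 0 <= Re z <= M.
Proof.
move=> bS saS S_ge0 hM z Sz.
have key (a : C) (c : R) : a != 0 -> 0 < c ->
    (forall F, c * rip F F <= rip (a *: (S F - z *: F)) F) -> False.
  move=> a0 c0 hc; apply: Sz.
  have bB : bounded_operator (fun F => a *: (S F - z *: F)).
    apply: bounded_operatorZ; have := bounded_operator_axpy (- z) bounded_operator_id bS.
    by congr bounded_operator; apply/funext => F; rewrite scaleNr addrC.
  have [B' bB' hB'] := coercive_inverse bB c0 hc.
  exists (fun F => B' (a *: F)).
    have := bounded_operator_comp bB' (bounded_operatorZ a bounded_operator_id).
    exact.
  move=> F; have [_ ->] := hB' F; split=> //.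
  by have [+ _] := hB' (a *: F) => /(scalerI a0).
have rip_iS F : rip ('i%C *: S F) F = 0.
  by have := rip_iskew (S F) F; rewrite saS (linear_opZ bS.1) (ripC F); lra.
have ripS a F : rip (a *: (S F - z *: F)) F = Re a * rip (S F) F - Re (a * z) * rip F F.
  by rewrite scalerBr ripBl scalerA (ripZ_diag _ (rip_iS F)) (ripZ_diag _ (rip_i F)).
have S_le F : rip (S F) F <= M * rip F F.
  by rewrite ripxx expr2 mulrA (le_trans (rip_le _ _))// ler_wpM2r ?L2_norm_ge0.
have i0 : ('i%C : C) != 0 by rewrite eq_complex /= oner_eq0 andbF.
have [Im0|Im0|Im0] := ltrgtP (Im z) 0.
- case: (key (- 'i%C) (- Im z)); rewrite ?oppr_eq0 ?oppr_gt0// => F.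
  rewrite ripS; case: (z) => x y /=; rewrite ?mulr0; lra.
- case: (key 'i%C (Im z)) => // F.
  rewrite ripS; case: (z) => x y /=; rewrite ?mulr0; lra.
split=> //; apply/andP; split; rewrite leNgt; apply/negP => Re0.
- case: (key 1 (- Re z)); rewrite ?oner_eq0 ?oppr_gt0// => F.
  by rewrite ripS mul1r /=; have := S_ge0 F; lra.
- case: (key (-1) (Re z - M)); rewrite ?oppr_eq0 ?oner_eq0 ?subr_gt0// => F.
  by rewrite ripS mulN1r; case: (z) => x y /=; have := S_le F; lra.
Qed.

End L2_operators.

(** * Polynomial approximation of powers *)

Section bernstein.
Context (R : realType).
Implicit Types (x e a b s M : R) (g h : nat -> R) (f : R -> R).

(** The [n]-th Bernstein polynomial of the values [g 0, ..., g n], that is, the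
    expectation of [g] under the binomial law, computed by conditioning on the
    first trial: this makes positivity and the variance plain inductions. *)
Fixpoint bernstein (n : nat) (g : nat -> R) : {poly R} :=
  if n is n'.+1 then 'X * bernstein n' (g \o succn) + (1 - 'X) * bernstein n' g
  else (g 0%N)%:P.

Lemma bernsteinS n g x : (bernstein n.+1 g).[x] =
  x * (bernstein n (g \o succn)).[x] + (1 - x) * (bernstein n g).[x].
Proof. by rewrite /= !hornerE. Qed.

Lemma le_bernstein n g h x : 0 <= x <= 1 ->
  (forall k, (k <= n)%N -> g k <= h k) -> (bernstein n g).[x] <= (bernstein n h).[x].
Proof.
move=> /andP[x0 x1]; elim: n g h => [|n ih] g h gh; first by rewrite !hornerE gh.
rewrite !bernsteinS; apply: lerD; apply: ler_wpM2l; rewrite ?subr_ge0//; apply: ih => k kn.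
  exact: gh.
by apply: gh; exact: leqW.
Qed.

Lemma bernstein_affine n g a b x :
  (bernstein n (fun k => a + b * g k)).[x] = a + b * (bernstein n g).[x].
Proof.
elim: n g => [|n ih] g; first by rewrite !hornerE.
by rewrite !bernsteinS ih -[X in (bernstein n X).[x]]/(fun k => a + b * (g \o succn) k) ih; ring.
Qed.

(** The squared bias plus the variance of the binomial law.  The induction on [n]
    shifts [a]. *)
Lemma bernstein_variance n a x :
  (bernstein n (fun k => (k%:R - a) ^+ 2)).[x] =
  (n%:R * x - a) ^+ 2 + n%:R * x * (1 - x).
Proof.
elim: n a => [|n ih] a; first by rewrite /= hornerC !mul0r addr0.
rewrite bernsteinS ih.
have -> : ((fun k => (k%:R - a) ^+ 2) \o succn) = (fun k => (k%:R - (a - 1)) ^+ 2 : R).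
  by apply/funext => k /=; rewrite -natr1; congr (_ ^+ _); ring.
by rewrite ih -natr1; ring.
Qed.

(** The modulus of continuity is required in the form [e + c (x - y)^2] because
    the expectation of [(k / n - x)^2] is explicit. *)
Lemma bernstein_approx f e (c : R) n x : 0 <= x <= 1 ->
  (forall x y, 0 <= x <= 1 -> 0 <= y <= 1 -> `|f x - f y| <= e + c * (x - y) ^+ 2) ->
  0 <= c -> (0 < n)%N ->
  `|(bernstein n (fun k => f (k%:R / n%:R))).[x] - f x| <= e + c / n%:R.
Proof.
move=> x01 hf c0 n0; have n0' : (0 : R) < n%:R by rewrite ltr0n.
have kn k : (k <= n)%N -> 0 <= (k%:R / n%:R : R) <= 1.
  by move=> kn; rewrite divr_ge0//= ler_pdivrMr// mul1r ler_nat.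
pose v k : R := (k%:R - n%:R * x) ^+ 2.
have hv k : c * (k%:R / n%:R - x) ^+ 2 = c / n%:R ^+ 2 * v k.
  by rewrite /v; field; rewrite gt_eqF.
have var : c / n%:R ^+ 2 * (bernstein n v).[x] <= c / n%:R.
  rewrite bernstein_variance subrr expr0n add0r.
  rewrite (_ : _ / _ * _ = (c / n%:R) * (x * (1 - x))).
    rewrite ler_piMr ?divr_ge0//; case/andP: x01 => x0 x1.
    by rewrite mulr_ile1// ?subr_ge0// gerBl.
  by field; rewrite gt_eqF.
rewrite ler_distl; apply/andP; split.
- apply: (@le_trans _ _ (bernstein n (fun k => (f x - e) + (- (c / n%:R ^+ 2)) * v k)).[x]).
    by rewrite bernstein_affine; lra.
  apply: le_bernstein => // k /kn hk.
  by have := hf _ _ hk x01; rewrite ler_distl hv => /andP[+ _]; lra.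
- apply: (@le_trans _ _ (bernstein n (fun k => (f x + e) + (c / n%:R ^+ 2) * v k)).[x]).
    apply: le_bernstein => // k /kn hk.
    by have := hf _ _ hk x01; rewrite ler_distl hv => /andP[_]; lra.
  by rewrite bernstein_affine; lra.
Qed.

(** Concavity: [t / (a + b) <= (t / (a + b)) ^ s] for [t] equal to [a] and to [b]. *)
Lemma powR_subadd s a b : 0 < s <= 1 -> 0 <= a -> 0 <= b ->
  (a + b) `^ s <= a `^ s + b `^ s.
Proof.
move=> /andP[s0 s1] a0 b0; have [ab0|ab0] := eqVneq (a + b) 0.
  by rewrite ab0 powR0 ?gt_eqF// addr_ge0 ?powR_ge0.
have ab_gt0 : 0 < a + b by rewrite lt_neqAle eq_sym ab0 addr_ge0.
have key t : 0 <= t <= a + b -> (a + b) `^ s * (t / (a + b)) <= t `^ s.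
  move=> /andP[t0 tab].
  have -> : t `^ s = (a + b) `^ s * (t / (a + b)) `^ s.
    by rewrite -powRM ?divr_ge0 ?(ltW ab_gt0)// mulrC divfK.
  rewrite ler_wpM2l ?powR_ge0//; have [->|t_neq0] := eqVneq t 0.
    by rewrite mul0r powR_ge0.
  rewrite -[leLHS]powRr1 ?divr_ge0 ?(ltW ab_gt0)//.
  have t_gt0 : 0 < t by rewrite lt_neqAle eq_sym t_neq0.
  by apply: ger_powR => //; rewrite divr_gt0//= ler_pdivrMr// mul1r.
have := key a; have := key b; rewrite a0 b0 lerDl lerDr a0 b0 => /(_ isT) h1 /(_ isT) h2.
apply: le_trans (lerD h2 h1); rewrite -mulrDr -mulrDl divff// mulr1//.
Qed.

Lemma powR_dist_le s x y : 0 < s <= 1 -> 0 <= x -> 0 <= y ->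
  `|x `^ s - y `^ s| <= `|x - y| `^ s.
Proof.
move=> s01; wlog xy : x y / y <= x => [wl x0 y0|x0 y0].
  have [/wl|/ltW/wl] := leP y x; first exact.
  by rewrite distrC (distrC x); exact.
have /andP[s0 _] := s01.
rewrite !ger0_norm ?subr_ge0//; last by rewrite ge0_ler_powR ?nnegrE// ltW.
by rewrite lerBlDr -[X in X `^ s <= _](subrK y) powR_subadd// subr_ge0.
Qed.

Lemma powR_modulus s e : 0 < s <= 1 -> 0 < e -> exists2 c, 0 <= c &
  forall x y, 0 <= x <= 1 -> 0 <= y <= 1 ->
    `|x `^ s - y `^ s| <= e + c * (x - y) ^+ 2.
Proof.
move=> s01 e0; have /andP[s0 s1] := s01.
pose del := e `^ s^-1.
have del0 : 0 < del by rewrite powR_gt0.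
exists (del ^- 2); first by rewrite invr_ge0 sqr_ge0.
move=> x y /andP[x0 x1] /andP[y0 y1]; apply: (le_trans (powR_dist_le s01 x0 y0)).
have [h|h] := leP `|x - y| del.
  apply: (@le_trans _ _ e).
    rewrite -[leRHS]powRr1 ?(ltW e0)// -(mulVf (lt0r_neq0 s0)) powRrM.
    by rewrite ge0_ler_powR ?nnegrE// ltW.
  by rewrite lerDl mulr_ge0 ?sqr_ge0// invr_ge0 sqr_ge0.
apply: (@le_trans _ _ 1).
  rewrite [leRHS](_ : 1 = 1 `^ s); last by rewrite powR1.
  apply: ge0_ler_powR; rewrite ?nnegrE ?ler01 ?(ltW s0)//.
  by rewrite ler_distl; apply/andP; split; lra.
apply: (@le_trans _ _ (del ^- 2 * (x - y) ^+ 2)); last by rewrite lerDr ltW.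
rewrite mulrC ler_pdivlMr ?exprn_gt0// mul1r -(real_normK (num_real (x - y))).
by rewrite ler_pXn2r ?nnegrE// ltW.
Qed.

(** Exponents above [1] reduce to exponents in [(0, 1]] by [x ^ s = x * x ^ (s - 1)]. *)
Lemma powR_approx01 s e : 0 < s -> 0 < e -> exists q : {poly R},
  forall x, 0 <= x <= 1 -> `|q.[x] - x `^ s| <= e.
Proof.
have [n] : exists n, s <= n.+1%:R.
  by exists (Num.truncn s); rewrite ltW// truncnS_gt.
elim: n s => [|n ih] s sn s0 e0.
  have e2 : 0 < e / 2 by rewrite divr_gt0.
  have s01 : 0 < s <= 1 by rewrite s0.
  have [c c0 hc] := powR_modulus s01 e2.
  have [n hn] : exists n, c / (e / 2) <= n.+1%:R.
    by exists (Num.truncn (c / (e / 2))); rewrite ltW// truncnS_gt.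
  exists (bernstein n.+1 (fun k => (k%:R / n.+1%:R) `^ s)) => x x01.
  have := bernstein_approx x01 hc c0 (ltn0Sn n) => /le_trans; apply.
  rewrite [leRHS](splitr e) lerD2l ler_pdivrMr ?ltr0n// mulrC.
  by rewrite -ler_pdivrMr.
have [s1|s1] := leP s 1; first by apply: ih => //; rewrite (le_trans s1)// ler1n.
have sn' : s - 1 <= n.+1%:R by rewrite lerBlDr natr1.
have s1' : 0 < s - 1 by rewrite subr_gt0.
have [q hq] := ih _ sn' s1' e0.
exists ('X * q) => x x01; have /andP[x0 x1] := x01.
rewrite !hornerE -mulr_powRB1// -mulrBr normrM ger0_norm//.
by rewrite (le_trans _ (hq x x01))// ler_piMl.
Qed.

Lemma powR_approx M s e : 0 < M -> 0 < s -> 0 < e -> exists q : {poly R},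
  forall x, 0 <= x <= M -> `|q.[x] - x `^ s| <= e.
Proof.
move=> M0 s0 e0; have Ms : 0 < M `^ s by rewrite powR_gt0.
have [q hq] := powR_approx01 s0 (divr_gt0 e0 Ms).
exists ((M `^ s)%:P * (q \Po (M^-1%:P * 'X))) => x /andP[x0 xM].
have x01 : 0 <= M^-1 * x <= 1.
  by rewrite mulr_ge0 ?invr_ge0 ?(ltW M0)//= mulrC ler_pdivrMr// mul1r.
rewrite !(hornerE, horner_comp).
have -> : x `^ s = M `^ s * (M^-1 * x) `^ s.
  by rewrite -powRM ?(ltW M0)//; [rewrite mulVKf ?gt_eqF|case/andP: x01].
rewrite -mulrBr normrM ger0_norm ?(ltW Ms)// mulrC -ler_pdivlMr//.
exact: hq.
Qed.

(** Squares of real polynomials approximate the powers: this is what makes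
    powers of positive operators positive. *)
Lemma powR_approx_sqr M s e : 0 < M -> 0 < s -> 0 < e -> exists q : {poly R},
  forall x, 0 <= x <= M -> `|(q * q).[x] - x `^ s| <= e.
Proof.
move=> M0 s0 e0; pose B := M `^ (s / 2).
have B0 : 0 <= B by exact: powR_ge0.
pose e' := Num.min 1 (e / (2 * B + 1)).
have B1 : 0 < 2 * B + 1 by rewrite ltr_wpDl ?mulr_ge0.
have e'0 : 0 < e' by rewrite lt_min ltr01 divr_gt0.
have e'1 : e' <= 1 by rewrite ge_min lexx.
have e'e : e' * (2 * B + 1) <= e by rewrite -ler_pdivlMr// ge_min lexx orbT.
have s2 : 0 < s / 2 by rewrite divr_gt0.
have [q hq] := powR_approx M0 s2 e'0.
exists q => x xM; have /andP[x0 xM'] := xM.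
have -> : x `^ s = x `^ (s / 2) * x `^ (s / 2).
  rewrite -powRD; first by congr (_ `^ _); lra.
  by rewrite -splitr gt_eqF.
rewrite hornerM; have := hq x xM.
have : x `^ (s / 2) <= B by rewrite ge0_ler_powR ?nnegrE// ltW.
have := powR_ge0 x (s / 2); set y := x `^ _; set z := q.[x] => y0 yB hz.
have -> : z * z - y * y = (z - y) * (z - y + 2 * y) by ring.
rewrite normrM (le_trans _ e'e)// ler_pM//.
rewrite (le_trans (ler_normD _ _))// addrC lerD//; last exact: le_trans hz e'1.
by rewrite ger0_norm ?mulr_ge0// ler_wpM2l.
Qed.

End bernstein.

(** * Positive powers of positive operators *)

Section functional_calculus.
Context d (X : measurableType d) (R : realType).
Variable mu : {measure set X -> \bar R}.
Local Notation C := R[i].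
Local Notation H := (L2 mu).
Implicit Types (F G K : H) (S B D : H -> H) (z a : C) (r s e : R) (p q : {poly C}).

Lemma le0_small (x K : R) : 0 <= K -> (forall e, 0 < e -> x <= K * e) -> x <= 0.
Proof.
move=> K0 h; rewrite leNgt; apply/negP => x0.
have K1 : 0 < K + 1 by rewrite ltr_wpDl.
have := h (x / (K + 1)) (divr_gt0 x0 K1); rewrite leNgt => /negP; apply.
by rewrite mulrCA gtr_pMr// ltr_pdivrMr// mul1r ltrDl.
Qed.

Lemma normL2_small F (K : R) : 0 <= K ->
  (forall e, 0 < e -> L2_norm F <= K * e) -> F = 0.
Proof.
move=> K0 h; apply/L2_norm_eq0/eqP; rewrite eq_le L2_norm_ge0 andbT.
exact: (le0_small K0).
Qed.

(** A uniform upper bound on the size frees sums of polynomials from their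
    actual sizes. *)
Lemma operator_poly_widen n p S F : (size p <= n)%N ->
  operator_poly p S F = \sum_(i < n) p`_i *: iter i S F.
Proof.
move=> pn; rewrite /operator_poly (big_ord_widen_cond _ xpredT (fun i => p`_i *: iter i S F) pn).
rewrite big_mkcond; apply: eq_bigr => i _ /=.
by case: ltnP => // hi; rewrite nth_default ?scale0r.
Qed.

Lemma operator_polyD p q S F :
  operator_poly (p + q) S F = operator_poly p S F + operator_poly q S F.
Proof.
pose n := maxn (size p) (size q).
rewrite (@operator_poly_widen n (p + q)) ?(leq_trans (size_polyD _ _))//.
rewrite (@operator_poly_widen n p) ?leq_maxl// (@operator_poly_widen n q) ?leq_maxr//.
by rewrite -big_split /=; apply: eq_bigr => i _; rewrite coefD scalerDl.
Qed.

Lemma operator_polyZ a p S F : operator_poly (a *: p) S F = a *: operator_poly p S F.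
Proof.
rewrite (@operator_poly_widen (size p) (a *: p)) ?size_scale_leq//.
by rewrite scaler_sumr; apply: eq_bigr => i _; rewrite coefZ scalerA.
Qed.

Lemma operator_poly1 S F : operator_poly 1 S F = F.
Proof. by rewrite /operator_poly size_poly1 big_ord1 coef1 scale1r. Qed.

Lemma operator_polyC a S F : operator_poly a%:P S F = a *: F.
Proof. by rewrite -[a%:P]mulr1 mul_polyC operator_polyZ operator_poly1. Qed.

Lemma operator_polyMX p S F : operator_poly (p * 'X) S F = operator_poly p S (S F).
Proof.
rewrite (@operator_poly_widen (size p).+1) ?(leq_trans (size_polyMleq _ _))//; last first.
  by rewrite size_polyX addnC.
rewrite big_ord_recl coefMX eqxx scale0r add0r; apply: eq_bigr => i _.
by rewrite coefMX /= -iterSr.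
Qed.

Lemma operator_poly_comm p S D F : linear D -> (forall F, D (S F) = S (D F)) ->
  D (operator_poly p S F) = operator_poly p S (D F).
Proof.
move=> lD DS; elim/poly_ind: p F => [|p a ih] F.
  by rewrite -polyC0 !operator_polyC !scale0r (linear_op0 lD).
rewrite !operator_polyD !operator_polyMX !operator_polyC.
by rewrite (linear_opD lD) ih DS (linear_opZ lD).
Qed.

Lemma linear_operator_poly p S : linear S -> linear (operator_poly p S).
Proof.
move=> lS a F G; elim/poly_ind: p F G => [|p b ih] F G.
  by rewrite -polyC0 !operator_polyC !scale0r scaler0 addr0.
rewrite !operator_polyD !operator_polyMX !operator_polyC lS ih.
by rewrite !scalerDr !scalerA (mulrC a) addrACA.
Qed.

Lemma operator_polyM p q S F : linear S ->
  operator_poly (p * q) S F = operator_poly p S (operator_poly q S F).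
Proof.
move=> lS; elim/poly_ind: p F => [|p a ih] F.
  by rewrite mul0r -polyC0 !operator_polyC !scale0r.
rewrite mulrDl operator_polyD [RHS]operator_polyD mul_polyC operator_polyZ operator_polyC.
congr (_ + _); rewrite -mulrA (mulrC 'X) mulrA !operator_polyMX ih.
by congr operator_poly; rewrite (operator_poly_comm q F lS).
Qed.

(** Every term of [p(S)] but the constant one factors through [S]. *)
Lemma operator_poly_split p S F : linear S ->
  operator_poly p S F = S (operator_poly (p %/ 'X) S F) + p.[0] *: F.
Proof.
move=> lS; elim/poly_ind: p F => [|p a _] F.
  by rewrite div0p -polyC0 !operator_polyC !scale0r (linear_op0 lS) hornerC scale0r addr0.
rewrite operator_polyD operator_polyMX operator_polyC !hornerE; congr (_ + _).
rewrite -(operator_poly_comm p F lS)//; congr (S (operator_poly _ S F)).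
rewrite divpD mulpK ?polyX_eq0// divp_small ?addr0// size_polyX.
exact: leq_ltn_trans (size_polyC_leq1 _) _.
Qed.

Definition realpoly (p : {poly R}) : {poly C} := map_poly (real_complex R) p.

Lemma realpolyM (p q : {poly R}) : realpoly (p * q) = realpoly p * realpoly q.
Proof. exact: rmorphM. Qed.

Lemma realpoly_horner0 (p : {poly R}) : (realpoly p).[0] = (p.[0])%:C%C.
Proof. by rewrite -horner_map rmorph0. Qed.

Lemma selfadjoint_realpoly (p : {poly R}) S : linear S -> selfadjoint_op S ->
  selfadjoint_op (operator_poly (realpoly p) S).
Proof.
move=> lS saS; rewrite /realpoly; elim/poly_ind: p => [|p a ih] F G.
  by rewrite rmorph0 -polyC0 !operator_polyC !scale0r rip0l rip0r.
rewrite rmorphD rmorphM /= map_polyX map_polyC /=.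
rewrite !operator_polyD !operator_polyMX !operator_polyC ripDl ripDr ripZl ripZr.
by rewrite ih saS (operator_poly_comm _ _ lS).
Qed.

Definition positive_op S :=
  [/\ bounded_operator S, selfadjoint_op S & forall F, 0 <= rip (S F) F].

(** The spectrum lies in a segment [[0, M]], where squares of polynomials
    approximate [x ^ s] uniformly.  Since [0] is in that segment even if it is
    not in the spectrum, the constant terms are small as well. *)
Lemma power_approx S B s : positive_op S -> 0 < s ->
  functional_calculus S (fun z => (Re z `^ s)%:C%C) B ->
  forall e, 0 < e -> exists q : {poly R}, `|(q * q).[0]| <= e /\
    forall F, L2_norm (operator_poly (realpoly (q * q)) S F - B F) <= e * L2_norm F.
Proof.
move=> [bS saS S0] s0 [_ hB] e e0.
have [M M0 hM] := bounded_operator_bound bS.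
have [del del0 hdel] := hB e e0.
have de0 : 0 < Num.min del e by rewrite lt_min del0.
have [q hq] := powR_approx_sqr M0 s0 de0.
exists q; split.
  have := hq 0; rewrite lexx (ltW M0) powR0 ?gt_eqF// subr0 => /(_ isT) /le_trans; apply.
  by rewrite ge_min lexx orbT.
apply: hdel => z /(positive_spectrum bS saS S0 hM)[Imz Rez].
have zE : z = (Re z)%:C%C by rewrite [LHS]complexE Imz mulr0 addr0.
rewrite [z in horner _ z]zE /realpoly horner_map.
rewrite (_ : _ - _ = ((q * q).[Re z] - Re z `^ s)%:C%C); last by rewrite [RHS]rmorphB.
rewrite /normc /= expr0n /= addr0 sqrtr_sqr.
by rewrite (le_trans (hq _ Rez))// ge_min lexx.
Qed.

Section positive_power.
Context (S B : H -> H) (s : R).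
Hypotheses (posS : positive_op S) (s0 : 0 < s)
  (SB : functional_calculus S (fun z => (Re z `^ s)%:C%C) B).

Let bS : bounded_operator S. Proof. by case: posS. Qed.
Let bB : bounded_operator B. Proof. by case: SB. Qed.
Let approx := power_approx posS s0 SB.

Lemma power_positive : positive_op B.
Proof.
have [_ saS S_ge0] := posS; split=> // [F G|F].
  apply/eqP; rewrite -subr_eq0 -normr_le0.
  apply: (@le0_small _ (2 * (L2_norm F * L2_norm G))).
    by rewrite !mulr_ge0 ?L2_norm_ge0.
  move=> e e0; have [q [_ hq]] := approx e0.
  have sa := selfadjoint_realpoly (q * q) bS.1 saS.
  set P := operator_poly _ S in hq sa.
  have -> : rip (B F) G - rip F (B G) = rip F (P G - B G) - rip (P F - B F) G.
    by rewrite ripBl ripBr sa; ring.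
  rewrite (le_trans (ler_normB _ _))//.
  have h1 := le_trans (ler_norm_rip _ _) (ler_wpM2l (L2_norm_ge0 F) (hq G)).
  have h2 := le_trans (ler_norm_rip _ _) (ler_wpM2r (L2_norm_ge0 G) (hq F)).
  by apply: le_trans (lerD h1 h2) _; rewrite le_eqVlt; apply/orP; left; apply/eqP; ring.
rewrite -oppr_le0; apply: (@le0_small _ (L2_norm F ^+ 2)); first exact: sqr_ge0.
move=> e e0; have [q [_ hq]] := approx e0.
have sa := selfadjoint_realpoly q bS.1 saS.
have P_ge0 : 0 <= rip (operator_poly (realpoly (q * q)) S F) F.
  by rewrite realpolyM (operator_polyM _ _ _ bS.1) sa rip_ge0.
set P := operator_poly _ S in hq P_ge0.
have -> : - rip (B F) F = rip (P F - B F) F - rip (P F) F by rewrite ripBl; ring.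
rewrite lerBlDr (le_trans (rip_le _ _))// (le_trans (ler_wpM2r (L2_norm_ge0 F) (hq F)))//.
by rewrite -mulrA -expr2 mulrC lerDl.
Qed.

(** [D p(S)] is [p(0) D], and [p(0)] tends to [0 ^ s = 0]. *)
Lemma power_vanish D : bounded_operator D ->
  (forall F, D (S F) = 0) -> forall F, D (B F) = 0.
Proof.
move=> bD DS F; have [lD _] := bD; have [K K0 hK] := bounded_operator_bound bD.
apply: (@normL2_small _ (2 * K * L2_norm F)); first by rewrite !mulr_ge0 ?L2_norm_ge0 ?(ltW K0).
move=> e e0; have [q [q0 hq]] := approx e0.
set p := q * q in q0 hq.
have DpS : D (operator_poly (realpoly p) S F) = (p.[0])%:C%C *: D F.
  rewrite (operator_poly_split _ _ bS.1) (linear_opD lD) DS add0r (linear_opZ lD).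
  by rewrite realpoly_horner0.
rewrite -[B F](subKr (operator_poly (realpoly p) S F)) (linear_opB lD).
rewrite (le_trans (normL2B _ _))// DpS normL2Z.
have h1 : normc (p.[0])%:C%C * L2_norm (D F) <= e * (K * L2_norm F).
  rewrite ler_pM ?L2_norm_ge0 ?sqrtr_ge0//.
  by rewrite /normc /= expr0n addr0 sqrtr_sqr.
have h2 := le_trans (hK _) (ler_wpM2l (ltW K0) (hq F)).
by apply: le_trans (lerD h1 h2) _; rewrite le_eqVlt; apply/orP; left; apply/eqP; ring.
Qed.

Lemma power_kernel F : S F = 0 -> B F = 0.
Proof.
move=> SF; apply: (@normL2_small _ (2 * L2_norm F)); first by rewrite mulr_ge0 ?L2_norm_ge0.
move=> e e0; have [q [q0 hq]] := approx e0.
set p := q * q in q0 hq.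
have pS : operator_poly (realpoly p) S F = (p.[0])%:C%C *: F.
  rewrite (operator_poly_split _ _ bS.1).
  rewrite (operator_poly_comm _ F bS.1)// SF.
  have := linear_op0 (linear_operator_poly (realpoly p %/ 'X) bS.1) => ->.
  by rewrite add0r realpoly_horner0.
rewrite -[B F](subKr (operator_poly (realpoly p) S F)).
rewrite (le_trans (normL2B _ _))// pS normL2Z -pS.
have h1 : normc (p.[0])%:C%C * L2_norm F <= e * L2_norm F.
  by rewrite ler_wpM2r ?L2_norm_ge0// /normc /= expr0n addr0 sqrtr_sqr.
by apply: le_trans (lerD h1 (hq F)) _; rewrite le_eqVlt; apply/orP; left; apply/eqP; ring.
Qed.

Lemma power_comm D : bounded_operator D -> (forall F, D (S F) = S (D F)) ->
  forall F, D (B F) = B (D F).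
Proof.
move=> bD DS F; have [lD _] := bD; have [K K0 hK] := bounded_operator_bound bD.
apply/eqP; rewrite -subr_eq0; apply/eqP.
apply: (@normL2_small _ (2 * (K * L2_norm F))).
  by rewrite !mulr_ge0 ?L2_norm_ge0 ?(ltW K0).
move=> e e0; have [q [_ hq]] := approx e0.
have := operator_poly_comm (realpoly (q * q)) F lD DS.
set P := operator_poly _ S in hq * => DP.
have -> : D (B F) - B (D F) = (P (D F) - B (D F)) - D (P F - B F).
  by rewrite (linear_opB lD) DP opprB [RHS]addrC addrA subrK.
rewrite (le_trans (normL2B _ _))//.
have h1 := le_trans (hq (D F)) (ler_wpM2l (ltW e0) (hK F)).
have h2 := le_trans (hK _) (ler_wpM2l (ltW K0) (hq F)).
by apply: le_trans (lerD h1 h2) _; rewrite le_eqVlt; apply/orP; left; apply/eqP; ring.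
Qed.

End positive_power.
End functional_calculus.

(** * The power zero: projection onto the closure of the range *)

Section range_projection.
Context d (X : measurableType d) (R : realType).
Variable mu : {measure set X -> \bar R}.
Local Notation C := R[i].
Local Notation H := (L2 mu).
Implicit Types (F G K : H) (D : H -> H) (z a : C) (r s e : R).
Variables (S Q : H -> H).
Hypotheses (posS : positive_op S) (SQ : orthogonal_projection (range_closure S) Q).

Let bS : bounded_operator S. Proof. by case: posS. Qed.
Let saS : selfadjoint_op S. Proof. by case: posS. Qed.
Let V := range_closure S.

Let V_Q F : V (Q F). Proof. exact: (SQ F).1. Qed.

Let Q_orth F G : V G -> rip (F - Q F) G = 0.
Proof. by move=> /(SQ F).2; rewrite /rip => ->. Qed.

Let V_lin a F G : V F -> V G -> V (a *: F + G).
Proof.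
move=> VF VG e e0; pose e' := e / (normc a + 1).
have a0 : 0 <= normc a by exact: normc_ge0.
have a1 : 0 < normc a + 1 by rewrite ltr_wpDl.
have e'0 : 0 < e' by rewrite divr_gt0.
have [F' hF] := VF _ e'0; have [G' hG] := VG _ e'0.
exists (a *: F' + G'); rewrite bS.1.
have -> : a *: F + G - (a *: S F' + S G') = a *: (F - S F') + (G - S G').
  by rewrite scalerBr opprD addrACA.
rewrite (le_lt_trans (normL2D _ _))// normL2Z.
have -> : e = normc a * e' + e' by rewrite /e'; field; rewrite gt_eqF.
by rewrite ler_ltD// ler_wpM2l// ltW.
Qed.

Let V_range F : V (S F).
Proof. by move=> e e0; exists F; rewrite subrr normL2_0. Qed.

Let V0 : V 0. Proof. by have := V_range 0; rewrite (linear_op0 bS.1). Qed.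

Let Q_unique F Y : V Y -> (forall G, V G -> rip (F - Y) G = 0) -> Q F = Y.
Proof.
move=> VY hY; apply/eqP; rewrite -subr_eq0; apply/eqP/rip_eq0.
have VQY : V (Q F - Y) by rewrite -scaleN1r addrC; exact: V_lin.
rewrite -[X in rip X _](_ : (F - Y) - (F - Q F) = _); first by rewrite ripBl hY// Q_orth// subrr.
by rewrite opprB addrC addrA subrK.
Qed.

Lemma projection_kernel F : S F = 0 -> Q F = 0.
Proof.
move=> SF; apply: Q_unique => // G VG; rewrite subr0; apply/eqP; rewrite -normr_le0.
apply: (@le0_small _ _ (L2_norm F)); first exact: L2_norm_ge0.
move=> e e0; have [K hK] := VG _ e0.
rewrite -(subrK (S K) G) ripDr -saS SF rip0l addr0.
by rewrite (le_trans (ler_norm_rip _ _))// ler_wpM2l ?L2_norm_ge0// ltW.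
Qed.

Lemma projection_selfadjoint : selfadjoint_op Q.
Proof.
move=> F G; apply: (@etrans _ _ (rip (Q F) (Q G))).
  by apply/eqP; rewrite -subr_eq0 -ripBr ripC Q_orth.
by apply/eqP; rewrite eq_sym -subr_eq0 -ripBl Q_orth.
Qed.

Lemma projection_bounded : bounded_operator Q.
Proof.
split=> [a F G|].
  apply: Q_unique => [|K VK]; first exact: V_lin.
  have -> : a *: F + G - (a *: Q F + Q G) = a *: (F - Q F) + (G - Q G).
    by rewrite scalerBr opprD addrACA.
  rewrite ripDl ripZc !Q_orth ?addr0//.
  by rewrite -[_ *: K]addr0; exact: V_lin.
exists 1 => F; rewrite mul1r.
have [F0|F0] := eqVneq (L2_norm (Q F)) 0; first by rewrite F0 L2_norm_ge0.
have Q_gt0 : 0 < L2_norm (Q F) by rewrite lt_neqAle eq_sym F0 L2_norm_ge0.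
rewrite -(ler_pM2r Q_gt0) -expr2 -ripxx (le_trans _ (rip_le _ _))//.
by rewrite -subr_ge0 -ripBl Q_orth.
Qed.

Lemma projection_vanish D : bounded_operator D ->
  (forall F, D (S F) = 0) -> forall F, D (Q F) = 0.
Proof.
move=> bD DS F; have [K K0 hK] := bounded_operator_bound bD.
apply: (@normL2_small _ _ _ _ _ K); first exact: ltW.
move=> e e0; have [G hG] := V_Q F e0.
rewrite -(subrK (S G) (Q F)) (linear_opD bD.1) DS addr0 (le_trans (hK _))//.
by rewrite ler_wpM2l// ltW.
Qed.

Lemma projection_comm D D' : bounded_operator D -> is_adjoint D D' ->
  (forall F, D (S F) = S (D F)) -> (forall F, D' (S F) = S (D' F)) ->
  forall F, D (Q F) = Q (D F).
Proof.
have V_inv E : bounded_operator E -> (forall F, E (S F) = S (E F)) ->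
    forall F, V F -> V (E F).
  move=> bE ES F VF e e0; have [K K0 hK] := bounded_operator_bound bE.
  have [G hG] := VF _ (divr_gt0 e0 K0); exists (E G).
  by rewrite -ES -(linear_opB bE.1) (le_lt_trans (hK _))// mulrC -ltr_pdivlMr.
move=> bD DD' DS D'S F; apply/esym/Q_unique => [|G VG]; first exact: V_inv.
rewrite -(linear_opB bD.1) (adjoint_rip DD') Q_orth//.
by apply: V_inv => //; case: DD'.
Qed.

End range_projection.

(** The powers with [s > 0] (functional calculus) and with [s = 0] (projection)
    share a few properties, which suffice for the transformation. *)
Section is_power.
Context d (X : measurableType d) (R : realType).
Variable mu : {measure set X -> \bar R}.
Local Notation H := (L2 mu).
Implicit Types (F G K : H) (D : H -> H).
Variables (S B : H -> H) (s : R).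
Hypotheses (posS : positive_op S) (s0 : 0 <= s) (SB : is_power S s B).

Lemma is_power_bounded : bounded_operator B.
Proof.
move: SB; rewrite /is_power; case: eqVneq => [_|s_neq0 [//]].
exact: projection_bounded.
Qed.

Lemma is_power_selfadjoint : selfadjoint_op B.
Proof.
move: SB; rewrite /is_power; case: eqVneq => [_ h|s_neq0 h].
  exact: (projection_selfadjoint h).
by have [] : positive_op B by apply: (power_positive posS _ h); rewrite lt_neqAle eq_sym s_neq0.
Qed.

Lemma is_power_kernel F : S F = 0 -> B F = 0.
Proof.
move: SB; rewrite /is_power; case: eqVneq => [_ h|s_neq0 h].
  exact: (projection_kernel posS h).
by apply: (power_kernel posS _ h); rewrite lt_neqAle eq_sym s_neq0.
Qed.

Lemma is_power_vanish D : bounded_operator D ->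
  (forall F, D (S F) = 0) -> forall F, D (B F) = 0.
Proof.
move: SB; rewrite /is_power; case: eqVneq => [_ h|s_neq0 h] bD DS F.
  exact: (projection_vanish h bD DS).
by apply: (power_vanish posS _ h bD DS); rewrite lt_neqAle eq_sym s_neq0.
Qed.

Lemma is_power_comm D D' : bounded_operator D -> is_adjoint D D' ->
  (forall F, D (S F) = S (D F)) -> (forall F, D' (S F) = S (D' F)) ->
  forall F, D (B F) = B (D F).
Proof.
move: SB; rewrite /is_power; case: eqVneq => [_ h bD DD' DS D'S F|s_neq0 h].
  exact: (projection_comm posS h bD DD' DS D'S).
move=> bD _ DS _; apply: (power_comm posS _ h) => //.
by rewrite lt_neqAle eq_sym s_neq0.
Qed.

End is_power.

(** * Multiplication operators *)

(** The sum is the integer part of [t]. *)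
Lemma sum_thresholds (R : realType) (n : nat) (t : R) : 0 <= t <= n%:R ->
  `|\sum_(k < n) (k.+1%:R <= t)%R%:R - t| <= 1.
Proof.
have full m : m%:R <= t -> \sum_(k < m) (k.+1%:R <= t)%R%:R = m%:R :> R.
  move=> mt; rewrite (eq_bigr (fun _ => 1)) ?sumr_const ?card_ord// => k _.
  by rewrite (le_trans _ mt)// ler_nat.
elim: n => [|n ih] /andP[t0 tn].
  by rewrite big_ord0 sub0r normrN ger0_norm// (le_trans tn).
have [nt|tn'] := leP n%:R t; last first.
  rewrite big_ord_recr /= [_ <= t]leNgt (lt_trans tn') ?ltr_nat//= addr0.
  by rewrite ih// t0 ltW.
rewrite big_ord_recr /= full//; rewrite -natr1 in tn *.
by case: (leP (n%:R + 1) t) => h; rewrite /= ?mulr1n ?mulr0n ?addr0 ler_norml;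
  apply/andP; split; lra.
Qed.

Section multiplication.
Context d (X : measurableType d) (R : realType).
Variable mu : {measure set X -> \bar R}.
Local Notation C := R[i].
Local Notation H := (L2 mu).
Implicit Types (F G K : H) (D : H -> H) (f psi phi : X -> C) (z a : C) (r s e : R).

(** For chaining any number of almost everywhere equalities. *)
Lemma aeq_mp f psi (P : X -> Prop) : f = psi %[ae mu] ->
  (\forall x \ae mu, f x = psi x -> P x) -> \forall x \ae mu, P x.
Proof. by apply: filterS2 => x /= h; apply; exact: h. Qed.

Lemma nsqM z a : nsq (z * a) = nsq z * nsq a.
Proof. by rewrite !nsqE ComplexField.Normc.normcM exprMn. Qed.

Definition multiplier psi :=
  cmeasurable psi /\ exists M : R, forall x, normc (psi x) <= M.

Definition mulop psi F : H := toL2 mu (fun x => psi x * F x).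

Lemma mulL2_bound psi F (M : R) : cmeasurable psi -> (forall x, normc (psi x) <= M) ->
  (\int[mu]_x (nsq (psi x * F x))%:E <= ((M * L2_norm F) ^+ 2)%:E)%E.
Proof.
move=> mpsi hM; rewrite exprMn EFinM L2_norm_sqr -ge0_integralZl_EFin//.
- apply: ge0_le_integral => //.
  + by move=> x _; rewrite lee_fin nsq_ge0.
  + by apply/measurable_EFinP/cmeasurable_nsq/cmeasurableM => //; exact: L2_cmeasurable.
  + by apply/measurable_EFinP/measurable_funM => //; apply/cmeasurable_nsq/L2_cmeasurable.
  + move=> x _; rewrite -EFinM lee_fin nsqM ler_wpM2r ?nsq_ge0//.
    by rewrite nsqE ler_pXn2r ?nnegrE ?normc_ge0 ?(le_trans (normc_ge0 _) (hM x)).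
- by move=> x _; rewrite lee_fin nsq_ge0.
- exact/measurable_EFinP/cmeasurable_nsq/L2_cmeasurable.
- exact: sqr_ge0.
Qed.

Lemma mulopE psi F : multiplier psi ->
  (mulop psi F : X -> C) = (fun x => psi x * F x) %[ae mu].
Proof.
move=> [mpsi [M hM]]; apply: toL2E; apply/L2predP; split.
  by apply: cmeasurableM => //; exact: L2_cmeasurable.
by rewrite (le_lt_trans (mulL2_bound F mpsi hM))// ltry.
Qed.

Lemma mulop_norm psi F (M : R) : cmeasurable psi -> (forall x, normc (psi x) <= M) ->
  L2_norm (mulop psi F) <= M * L2_norm F.
Proof.
move=> mpsi hM; have M0 : 0 <= M := le_trans (normc_ge0 _) (hM point).
rewrite -(ler_pXn2r (n := 2))// ?nnegrE ?mulr_ge0 ?L2_norm_ge0//.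
have mm : multiplier psi by split=> //; exists M.
rewrite -lee_fin (L2_norm_ae (mulopE F mm)); first exact: mulL2_bound.
by apply: cmeasurableM => //; exact: L2_cmeasurable.
Qed.

Lemma linear_mulop psi : multiplier psi -> linear (mulop psi).
Proof.
move=> mpsi a F G; apply/L2_eqP.
apply: (aeq_mp (mulopE (a *: F + G) mpsi)); apply: (aeq_mp (mulopE F mpsi)).
apply: (aeq_mp (mulopE G mpsi)); apply: (aeq_mp (L2_reprD (a *: F) G)).
apply: (aeq_mp (L2_reprZ a F)); apply: (aeq_mp (L2_reprD (a *: mulop psi F) (mulop psi G))).
apply: (aeq_mp (L2_reprZ a (mulop psi F))).
apply: aeW => x e1 e2 e3 e4 e5 e6 e7 _; rewrite e7 e4 e3 e2 e1 e6 e5.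
by rewrite mulrDr mulrCA.
Qed.

Lemma bounded_mulop psi : multiplier psi -> bounded_operator (mulop psi).
Proof.
move=> mpsi; split; first exact: linear_mulop.
by have [m [M hM]] := mpsi; exists M => F; exact: mulop_norm.
Qed.

Lemma multiplier_conj psi : multiplier psi -> multiplier (fun x => conjc (psi x)).
Proof.
move=> [mp [M hM]]; split; first exact: cmeasurable_conj.
by exists M => x; rewrite normc_conj.
Qed.

Lemma mulop_adjoint psi : multiplier psi ->
  is_adjoint (mulop psi) (mulop (fun x => conjc (psi x))).
Proof.
move=> mpsi; have mpsi' := multiplier_conj mpsi.
apply: rip_adjoint; first exact: bounded_mulop.
have [mp _] := mpsi; have [mp' _] := mpsi'.
move=> F G; rewrite (rip_ae (mulopE F mpsi) (ae_eq_refl _ _ _)); last exact: L2_cmeasurable.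
  rewrite (rip_ae (ae_eq_refl _ _ _) (mulopE G mpsi')).
  - by apply: eq_Rintegral => x _; rewrite dotcMl.
  - exact: L2_cmeasurable.
  - by apply: cmeasurableM => //; exact: L2_cmeasurable.
by apply: cmeasurableM => //; exact: L2_cmeasurable.
Qed.

Lemma multiplier_axpy a psi phi : multiplier psi -> multiplier phi ->
  multiplier (fun x => a * psi x + phi x).
Proof.
move=> [mp [M hM]] [mp' [M' hM']]; split.
  by apply: cmeasurableD => //; apply: (cmeasurableM (f := cst a)) => //; exact: cmeasurable_cst.
exists (normc a * M + M') => x; rewrite (le_trans (le_normcD _ _))//.
by rewrite lerD// ComplexField.Normc.normcM ler_wpM2l ?normc_ge0.
Qed.

Lemma mulop_axpy a psi phi F : multiplier psi -> multiplier phi ->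
  mulop (fun x => a * psi x + phi x) F = a *: mulop psi F + mulop phi F.
Proof.
move=> mp mp'; apply/L2_eqP.
apply: (aeq_mp (mulopE F mp)); apply: (aeq_mp (mulopE F mp')).
apply: (aeq_mp (mulopE F (multiplier_axpy a mp mp'))).
apply: (aeq_mp (L2_reprD (a *: mulop psi F) (mulop phi F))).
apply: (aeq_mp (L2_reprZ a (mulop psi F))).
by apply: aeW => x e1 e2 e3 e4 e5 _; rewrite e3 e2 e1 e4 e5 mulrDl mulrA.
Qed.

Lemma multiplier_cst a : multiplier (cst a).
Proof. by split; [exact: cmeasurable_cst|exists (normc a)]. Qed.

Lemma mulop_cst a F : mulop (cst a) F = a *: F.
Proof.
apply/L2_eqP; apply: (aeq_mp (mulopE F (multiplier_cst a))).
by apply: (aeq_mp (L2_reprZ a F)); apply: aeW => x e1 e2 _; rewrite e1 e2.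
Qed.

Definition indicc (B : set X) : X -> C := fun x => (\1_B x)%:C%C.

Lemma indicc_conj (B : set X) : (fun x => conjc (indicc B x)) = indicc B.
Proof. by apply/funext => x; rewrite /indicc conjc_real. Qed.

Lemma multiplier_indicc (B : set X) : measurable B -> multiplier (indicc B).
Proof.
move=> mB; split; first by split; [exact: measurable_indic|exact: measurable_cst].
exists 1 => x; rewrite normc_real_ge0 indicE ?ler0n//.
by case: (_ \in _); rewrite ?ler01.
Qed.

Section commutation.
Variables (A : set (set X)).
Hypotheses (A_sigma_algebra : sigma_algebra [set: X] A) (A_sub : A `<=` measurable).
Local Notation XA := (g_sigma_algebraType A).

Lemma g_sigma_measurableE (B : set X) : measurable (B : set XA) = A B.
Proof. by rewrite /measurable /= sigma_algebra_id. Qed.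

Lemma sub_measurable_fun (d' : measure_display) (Y : measurableType d') (g : X -> Y) :
  measurable_fun setT (g : XA -> Y) -> measurable_fun setT g.
Proof. by move=> mg _ B mB; apply: A_sub; rewrite -g_sigma_measurableE; exact: mg. Qed.

Lemma sub_cmeasurable f : @cmeasurable _ XA R f -> cmeasurable f.
Proof. by move=> [? ?]; split; exact: sub_measurable_fun. Qed.

Variable (D : H -> H).
Hypotheses (bD : bounded_operator D)
  (DA : forall B, A B -> forall F, D (mulop (indicc B) F) = mulop (indicc B) (D F)).

Let com psi := multiplier psi /\ forall F, D (mulop psi F) = mulop psi (D F).

Let com_axpy a psi phi : com psi -> com phi -> com (fun x => a * psi x + phi x).
Proof.
move=> [mp cp] [mp' cp']; split; first exact: multiplier_axpy.
by move=> F; rewrite !mulop_axpy// bD.1 cp cp'.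
Qed.

Let com_cst a : com (cst a).
Proof.
split; first exact: multiplier_cst.
by move=> F; rewrite !mulop_cst (linear_opZ bD.1).
Qed.

(** The step functions [1/N * #{k : k <= N h}] converge to [h] uniformly, hence
    the multiplications by them converge in operator norm. *)
Let com_real (h : X -> R) : measurable_fun setT (h : XA -> R) ->
  (forall x, 0 <= h x <= 1) -> com (fun x => (h x)%:C%C).
Proof.
move=> mh h01.
have mm : multiplier (fun x => (h x)%:C%C).
  split; first by split; [exact: sub_measurable_fun|exact: measurable_cst].
  by exists 1 => x; have /andP[h0 h1] := h01 x; rewrite normc_real_ge0.
split=> // F; have [K K0 hK] := bounded_operator_bound bD.
apply/eqP; rewrite -subr_eq0; apply/eqP.
apply: (@normL2_small _ _ _ _ _ (2 * (K * L2_norm F))).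
  by rewrite !mulr_ge0 ?L2_norm_ge0 ?(ltW K0).
move=> e e0; have [n hn] : exists n, e^-1 <= n.+1%:R.
  by exists (Num.truncn e^-1); rewrite ltW// truncnS_gt.
pose N : R := n.+1%:R; have N0 : 0 < N by rewrite ltr0n.
have Ne : N^-1 <= e by rewrite -[leRHS]invrK lef_pV2 ?posrE ?invr_gt0.
pose B k := [set x | k.+1%:R <= N * h x].
have AB k : A (B k).
  rewrite -g_sigma_measurableE -[B k]setTI.
  have mNh : measurable_fun setT (fun x : XA => N * h x) by exact: measurable_funM.
  rewrite (_ : B k = (fun x => N * h x) @^-1` `[k.+1%:R, +oo[%classic).
    exact: mNh.
  by apply/seteqP; split=> x; rewrite /B /= in_itv /= andbT.
pose phi m x : C := \sum_(k < m) indicc (B k) x.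
have com_phi m : com (phi m).
  elim: m => [|m ih].
    by rewrite (_ : phi 0%N = cst 0)//; apply/funext => x; rewrite /phi big_ord0.
  rewrite (_ : phi m.+1 = (fun x => 1 * phi m x + indicc (B m) x)).
    apply: com_axpy => //; split; last by move=> G; exact: DA.
    by apply: multiplier_indicc; exact: A_sub.
  by apply/funext => x; rewrite /phi big_ord_recr mul1r.
pose hN x : C := (N^-1)%:C%C * phi n.+1 x + cst 0 x.
have [mN cN] : com hN by exact: com_axpy.
pose psi x : C := (-1) * hN x + (h x)%:C%C.
have psi_le x : normc (psi x) <= e.
  rewrite /psi /hN addr0 mulN1r.
  have -> : phi n.+1 x = (\sum_(k < n.+1) (k.+1%:R <= N * h x)%R%:R : R)%:C%C.
    rewrite /phi rmorph_sum; apply: eq_bigr => k _; rewrite /indicc indicE.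
    by congr ((_ : bool)%:R%:C)%C; apply/idP/idP; rewrite inE.
  have /andP[h0 h1] := h01 x.
  have := @sum_thresholds R n.+1 (N * h x); rewrite mulr_ge0 ?(ltW N0)//=.
  rewrite -[leRHS]mulr1 ler_pM2l// h1 => /(_ isT).
  set s := \sum_(_ < _) _ => hs.
  rewrite !mul0r !mulr0 subr0 !addr0 oppr0 expr0n addr0 sqrtr_sqr.
  rewrite (le_trans _ Ne)// (_ : _ + _ = - (N^-1 * (s - N * h x))).
    by rewrite normrN normrM gtr0_norm ?invr_gt0// ler_piMr// invr_ge0 ltW.
  by field; rewrite gt_eqF.
have mpsi : multiplier psi by exact: multiplier_axpy.
have decomp G : mulop (fun x => (h x)%:C%C) G = mulop psi G + mulop hN G.
  by rewrite mulop_axpy// scaleN1r addrAC addNr add0r.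
rewrite !decomp (linear_opD bD.1) cN opprD addrACA subrr addr0.
have [cpsi _] := mpsi.
rewrite (le_trans (normL2B _ _))//.
rewrite (_ : 2 * _ * e = K * (e * L2_norm F) + e * (K * L2_norm F)); last by ring.
rewrite lerD//.
  by rewrite (le_trans (hK _))// ler_wpM2l ?(ltW K0)// mulop_norm.
by rewrite (le_trans (mulop_norm _ cpsi psi_le))// ler_wpM2l// ltW.
Qed.

(** The two parts of [psi] are moved from [[-1, 1]] to [[0, 1]] by an affine map. *)
Lemma commute_mulop psi : @cmeasurable _ XA R psi -> (forall x, normc (psi x) <= 1) ->
  forall F, D (mulop psi F) = mulop psi (D F).
Proof.
move=> [mr mi] hpsi F.
have range01 (y : R) : `|y| <= 1 -> 0 <= (y + 1) / 2 <= 1.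
  by rewrite ler_norml => /andP[? ?]; apply/andP; split; lra.
have normc_part (z : C) : `|Re z| <= normc z /\ `|Im z| <= normc z.
  case: z => a b; rewrite /normc /=; split; [rewrite -(sqrtr_sqr a)|rewrite -(sqrtr_sqr b)];
    by rewrite ler_wsqrtr// ?lerDl ?lerDr sqr_ge0.
have cr : com (fun x => ((Re (psi x) + 1) / 2)%:C%C).
  apply: com_real => [|x]; first by apply: measurable_funM => //; exact: measurable_funD.
  by apply: range01; rewrite (le_trans (normc_part _).1).
have ci : com (fun x => ((Im (psi x) + 1) / 2)%:C%C).
  apply: com_real => [|x]; first by apply: measurable_funM => //; exact: measurable_funD.
  by apply: range01; rewrite (le_trans (normc_part _).2).
have [_] := com_axpy 2%:R cr (com_axpy (2%:R * 'i%C) ci (com_cst (- (1 + 'i%C)))).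
set phi := (fun x => _) => h; rewrite (_ : psi = phi) ?h//.
apply/funext => x; rewrite /phi; case: (psi x) => a b /=.
apply/eqP; rewrite eq_complex /=; apply/andP; split; apply/eqP; rewrite ?mulr0 ?mul0r; by field.
Qed.

End commutation.
End multiplication.

(** * Existence and uniqueness of conditional expectations *)

Section conditional_expectation.
Context d (X : measurableType d) (R : realType).
Variable mu : {measure set X -> \bar R}.
Local Open Scope ereal_scope.
Implicit Types (f g : X -> \bar R) (B : set X).
Variable A : set (set X).
Hypotheses (A_sigma_algebra : sigma_algebra [set: X] A) (A_sub : A `<=` measurable).
Local Notation XA := (g_sigma_algebraType A).

Lemma A_measurable B : A B -> measurable (B : set XA).
Proof. by rewrite (g_sigma_measurableE A_sigma_algebra). Qed.

Lemma measurable_A B : measurable (B : set XA) -> A B.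
Proof. by rewrite (g_sigma_measurableE A_sigma_algebra). Qed.

Lemma measurable_id_trace : measurable_fun setT (id : X -> XA).
Proof. by apply: (sub_measurable_fun A_sigma_algebra A_sub); exact: measurable_id. Qed.

(** The restriction of [mu] to [A], on the type that carries [A] as its
    sigma-algebra.  The measurability argument records that [A] is made of
    measurable sets, so that the measure structure can be attached. *)
Definition trace_measure of (measurable_fun setT (id : X -> XA)) : set XA -> \bar R :=
  fun B => mu B.
Local Notation muA := (trace_measure measurable_id_trace).

Let trace0 : muA set0 = 0. Proof. exact: measure0. Qed.

Let trace_ge0 (B : set XA) : 0 <= muA B. Proof. exact: measure_ge0. Qed.

Let trace_sigma_additive : semi_sigma_additive muA.
Proof.
move=> F mF tF mUF; apply: measure_semi_sigma_additive => //.
- by move=> n; apply/A_sub/measurable_A.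
- exact/A_sub/measurable_A.
Qed.

HB.instance Definition _ := isMeasure.Build _ _ _ muA trace0 trace_ge0 trace_sigma_additive.

Lemma integral_trace B (g : XA -> \bar R) : A B -> measurable_fun setT g ->
  (forall x, 0 <= g x) -> \int[muA]_(x in B) g x = \int[mu]_(x in B) g x.
Proof.
move=> AB mg g0; have := @ge0_integral_pushforward _ _ X XA R id measurable_id_trace mu B g.
by apply => //; [exact: A_measurable|exact: measurable_funTS].
Qed.

Section density.
Variable f : X -> \bar R.
Hypotheses (f0 : forall x, 0 <= f x) (intf : mu.-integrable setT f).

Let mf : measurable_fun setT f. Proof. exact: measurable_int intf. Qed.

Definition trace_density of (mu.-integrable setT f) : set XA -> \bar R :=
  fun B => \int[mu]_(x in B) f x.
Local Notation nu := (trace_density intf).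

Let nu0 : nu set0 = 0. Proof. exact: integral_set0. Qed.
Let nu_ge0 (B : set XA) : 0 <= nu B. Proof. exact: integral_ge0. Qed.
Let nu_sigma_additive : semi_sigma_additive nu.
Proof.
move=> F mF tF mUF.
apply: (@semi_sigma_additive_nng_induced _ X R mu f mf f0 F _ tF).
- by move=> n; apply/A_sub/measurable_A.
- exact/A_sub/measurable_A.
Qed.
HB.instance Definition _ := isMeasure.Build _ _ _ nu nu0 nu_ge0 nu_sigma_additive.

Let nu_fin : fin_num_fun nu.
Proof.
move=> B mB; apply: integrable_fin_num; first exact/A_sub/measurable_A.
by apply: integrableS intf => //; exact/A_sub/measurable_A.
Qed.
HB.instance Definition _ := Measure_isFinite.Build _ _ _ nu nu_fin.

Hypothesis A_sigma_finite : sigma_finite [set: XA] muA.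
HB.instance Definition _ := Measure_isSigmaFinite.Build _ _ _ muA A_sigma_finite.

(** The density of [f . mu] with respect to [mu], both restricted to [A]. *)
Lemma integrable_version : exists g, [/\ sub_measurable A g, forall x, 0 <= g x &
  forall B, A B -> \int[mu]_(x in B) f x = \int[mu]_(x in B) g x].
Proof.
have nu_mu : nu `<< muA.
  apply/null_content_dominatesP => B mB muB0; apply: null_set_integral => //.
  - exact/A_sub/measurable_A.
  - exact: measurable_funTS.
have [g [g0 _ ig hg]] := radon_nikodym_sigma_finite nu_mu.
have mg := measurable_int _ ig.
exists g; split=> // B AB; rewrite -(integral_trace AB mg g0).
exact: (hg B (A_measurable AB)).
Qed.
End density.

Hypothesis A_sigma_finite : sigma_finite [set: XA] muA.

(** A finite-valued function is cut into integrable pieces, along a sequence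
    of [A]-sets of finite measure and along its own level sets. *)
Lemma nonneg_version f : measurable_fun setT f -> (forall x, 0 <= f x) ->
  (forall x, f x < +oo) -> exists g, [/\ sub_measurable A g, forall x, 0 <= g x &
  forall B, A B -> \int[mu]_(x in B) f x = \int[mu]_(x in B) g x].
Proof.
move=> mf f0 foo; have /sigma_finiteP[F [FT Fnd /all_and2[mF Foo]]] := A_sigma_finite.
have mFX k : measurable (F k : set X) by apply: A_sub; apply: measurable_A; exact: mF.
pose W k : set X := (F k : set X) `&` [set x | f x <= k%:R%:E].
have mW k : measurable (W k).
  apply: measurableI => //; rewrite -[X in measurable X]setTI.
  exact: emeasurable_fun_infty_c.
have WT : \bigcup_k W k = setT.
  apply/seteqP; split=> // x _; have [i _ Fix] : (\bigcup_k F k) x by rewrite -FT.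
  have fx : f x = (fine (f x))%:E by rewrite fineK// ge0_fin_numE.
  pose j := (Num.truncn (fine (f x))).+1.
  exists (maxn i j) => //; split.
    by have /subsetPset := Fnd _ _ (leq_maxl i j); apply.
  rewrite /= fx lee_fin (@le_trans _ _ j%:R)//; first by rewrite ltW// truncnS_gt.
  by rewrite ler_nat leq_maxr.
pose P := seqDU W.
have mP k : measurable (P k).
  by apply: measurableD => //; exact: bigsetU_measurable.
have PT : \bigcup_k P k = setT by rewrite -seqDU_bigcup_eq.
have tP : trivIset setT P := trivIset_seqDU W.
have PW k : P k `<=` W k by apply: subset_seqDU.
have intP k : mu.-integrable setT (f \_ (P k)).
  apply/(integrable_mkcond f (mP k)); apply/integrableP; split; first exact: measurable_funTS.
  apply: (@le_lt_trans _ _ (\int[mu]_(x in P k) k%:R%:E)).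
    apply: ge0_le_integral => //.
    - by apply: measurableT_comp => //; exact: measurable_funTS.
    - by move=> x /PW[_]; rewrite /= gee0_abs.
  rewrite integral_cst// lte_mul_pinfty ?lee_fin//.
  rewrite (le_lt_trans _ (Foo k))// le_measure ?inE//.
  by move=> x /PW[].
have f_ge0 k x : 0 <= (f \_ (P k)) x by rewrite patchE; case: ifP.
have [g] := choice (fun k => integrable_version (f_ge0 k) (intP k) A_sigma_finite).
move=> /all_and3[mg g0 hg].
exists (fun x => \sum_(0 <= k <oo) g k x); split.
- by apply: ge0_emeasurable_sum => // k _; exact: mg.
- by move=> x; apply: nneseries_ge0 => k *; exact: g0.
- move=> B AB; have mB := A_sub AB.
  have -> : B = \bigcup_k (B `&` P k) by rewrite -setI_bigcupr PT setIT.
  rewrite ge0_integral_bigcup//; last 3 first.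
  + by move=> k; exact: measurableI.
  + exact: measurable_funTS.
  + by apply: trivIset_setIl.
  rewrite -setI_bigcupr PT setIT integral_nneseries//.
    by apply: eq_eseriesr => k _; rewrite integral_mkcondr hg.
  by move=> k; apply: measurable_funTS; exact: (sub_measurable_fun A_sigma_algebra A_sub (mg k)).
Qed.

Lemma cond_exp_ge0P f : measurable_fun setT f -> (forall x, 0 <= f x) ->
  (forall x, f x < +oo) -> [/\ sub_measurable A (cond_exp_ge0 mu A f),
    forall x, 0 <= cond_exp_ge0 mu A f x &
    forall B, A B -> \int[mu]_(x in B) f x = \int[mu]_(x in B) cond_exp_ge0 mu A f x].
Proof.
by move=> mf f0 foo; have := xgetPex (cst 0) (nonneg_version mf f0 foo).
Qed.

(** On the [A]-sets of finite measure where [g1] is bounded, [g1] is integrable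
    and its integrals determine it. *)
Let unique_half g1 g2 : sub_measurable A g1 -> sub_measurable A g2 ->
  (forall x, 0 <= g1 x) -> (forall x, 0 <= g2 x) ->
  (forall B, A B -> \int[mu]_(x in B) g1 x = \int[mu]_(x in B) g2 x) ->
  \forall x \ae mu, g1 x < +oo -> g1 x = g2 x.
Proof.
move=> mg1 mg2 g10 g20 h; have /sigma_finiteP[F [FT Fnd /all_and2[mF Foo]]] := A_sigma_finite.
pose W k : set XA := F k `&` [set x | g1 x <= k%:R%:E].
have mW k : measurable (W k).
  apply: measurableI => //; rewrite -[X in measurable X]setTI.
  exact: emeasurable_fun_infty_c.
have piece k : ae_eq muA (W k) g1 g2.
  apply: integral_ae_eq => //.
  - apply/integrableP; split; first exact: measurable_funTS.
    apply: (@le_lt_trans _ _ (\int[muA]_(x in W k) k%:R%:E)).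
      apply: ge0_le_integral => //.
      + by apply: measurableT_comp => //; exact: measurable_funTS.
      + by move=> x [_]; rewrite /= gee0_abs.
    rewrite integral_cst// lte_mul_pinfty ?lee_fin//.
    rewrite (le_lt_trans _ (Foo k))// le_measure ?inE//.
    by move=> x [].
  - exact: measurable_funTS.
  - move=> E EW mE; rewrite !integral_trace//; first by apply/h/measurable_A.
      exact/measurable_A.
    exact/measurable_A.
have piece' k : \forall x \ae mu, (W k : set X) x -> g1 x = g2 x.
  have [N [mN N0 sN]] := piece k; exists N; split=> //.
  exact/A_sub/measurable_A.
have : \forall x \ae mu, forall k, (W k : set X) x -> g1 x = g2 x by apply: ae_foralln.
apply: filterS => x hx g1oo.
have [i _ Fix] : (\bigcup_k F k) x by rewrite -FT.
have fx : g1 x = (fine (g1 x))%:E by rewrite fineK// ge0_fin_numE.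
pose j := (Num.truncn (fine (g1 x))).+1.
apply: (hx (maxn i j)); split.
  by have /subsetPset := Fnd _ _ (leq_maxl i j); apply.
rewrite /= fx lee_fin (@le_trans _ _ j%:R)//; first by rewrite ltW// truncnS_gt.
by rewrite ler_nat leq_maxr.
Qed.

Lemma version_unique g1 g2 : sub_measurable A g1 -> sub_measurable A g2 ->
  (forall x, 0 <= g1 x) -> (forall x, 0 <= g2 x) ->
  (forall B, A B -> \int[mu]_(x in B) g1 x = \int[mu]_(x in B) g2 x) ->
  \forall x \ae mu, g1 x = g2 x.
Proof.
move=> mg1 mg2 g10 g20 h.
have h1 := unique_half mg1 mg2 g10 g20 h.
have h2 := unique_half mg2 mg1 g20 g10 (fun B AB => esym (h B AB)).
apply: filterS2 h1 h2 => x e1 e2.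
have [g1y|] := eqVneq (g1 x) +oo; last by rewrite -ltey => /e1.
have [g2y|] := eqVneq (g2 x) +oo; last by rewrite -ltey => /e2.
by rewrite g1y g2y.
Qed.

Lemma cond_exp_ge0_restrict f1 f2 B :
  measurable_fun setT f1 -> (forall x, 0 <= f1 x) -> (forall x, f1 x < +oo) ->
  measurable_fun setT f2 -> (forall x, 0 <= f2 x) -> (forall x, f2 x < +oo) ->
  A B -> (\forall x \ae mu, f2 x = (f1 \_ B) x) ->
  \forall x \ae mu, cond_exp_ge0 mu A f2 x = (cond_exp_ge0 mu A f1 \_ B) x.
Proof.
move=> mf1 f10 f1y mf2 f20 f2y AB f21.
have [me1 e10 he1] := cond_exp_ge0P mf1 f10 f1y.
have [me2 e20 he2] := cond_exp_ge0P mf2 f20 f2y.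
apply: version_unique => //.
- by apply/(measurable_restrictT _ (A_measurable AB)); exact: measurable_funTS.
- by move=> x; rewrite patchE; case: ifP.
move=> B' AB'; rewrite -he2// -integral_mkcondr -he1; last first.
  by apply/measurable_A/measurableI; exact: A_measurable.
rewrite integral_mkcondr; apply: ae_eq_integral => //.
- exact: A_sub.
- exact: measurable_funTS.
- by apply: measurable_funTS; apply/(measurable_restrictT _ (A_sub AB)); exact: measurable_funTS.
- by apply: filterS f21 => x e _.
Qed.

End conditional_expectation.

(** * Rank-one operators over the [A]-measurable functions *)

Section rank_one_over_A.
Context d (X : measurableType d) (R : realType).
Variable mu : {measure set X -> \bar R}.
Local Notation C := R[i].
Local Notation H := (L2 mu).
Implicit Types (F G K : H) (psi : X -> C).
Variable A : set (set X).
Hypotheses (A_sigma_algebra : sigma_algebra [set: X] A) (A_sub : A `<=` measurable).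
Local Notation XA := (g_sigma_algebraType A).

Definition commutes_with_sets (D : H -> H) := 
  forall B, A B -> forall F, D (mulop (indicc R B) F) = mulop (indicc R B) (D F).

Definition unit_multiplier psi :=
  @cmeasurable _ XA R psi /\ forall x, normc (psi x) <= 1.

Lemma unit_multiplierP psi : unit_multiplier psi -> multiplier psi.
Proof. by move=> [mp p1]; split; [exact: (sub_cmeasurable A_sigma_algebra A_sub mp)|exists 1]. Qed.

Lemma adjoint_comm (D D' : H -> H) psi : is_adjoint D D' -> multiplier psi ->
  (forall F, D (mulop (fun x => conjc (psi x)) F) = mulop (fun x => conjc (psi x)) (D F)) ->
  forall F, D' (mulop psi F) = mulop psi (D' F).
Proof.
move=> DD' mp Dp F; apply: rip_inj => G.
rewrite ripC -(adjoint_rip DD') ripC (adjoint_rip (mulop_adjoint mu mp)).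
by rewrite -Dp ripC (adjoint_rip DD') ripC -(adjoint_rip (mulop_adjoint mu mp)).
Qed.

Lemma multiplier_set B : A B -> multiplier (indicc R B).
Proof. by move=> AB; exact/multiplier_indicc/A_sub. Qed.

Lemma adjoint_commutes_with_sets (D D' : H -> H) : is_adjoint D D' ->
  commutes_with_sets D -> commutes_with_sets D'.
Proof.
move=> DD' DA B AB; apply: (adjoint_comm DD'); first exact: multiplier_set.
by rewrite indicc_conj; exact: DA.
Qed.

Lemma unit_multiplier_conj psi : unit_multiplier psi ->
  unit_multiplier (fun x => conjc (psi x)).
Proof.
by move=> [mp h]; split=> [|x]; [exact: cmeasurable_conj|rewrite normc_conj].
Qed.

Variables (T N N' : H -> H) (w : X -> C) (a : H -> X -> C).
Hypotheses (bT : bounded_operator T) (am : forall F, @cmeasurable _ XA R (a F))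
  (TE : forall F, (T F : X -> C) = (fun x => w x * a F x) %[ae mu])
  (TA : commutes_with_sets T).
Hypotheses (bN : bounded_operator N) (NN' : is_adjoint N N') (NA : commutes_with_sets N)
  (Nker : forall F, T F = 0 -> N F = 0) (N'ker : forall F, T F = 0 -> N' F = 0).

Let bN' : bounded_operator N'. Proof. by case: NN'. Qed.

Let Tcom psi F : unit_multiplier psi -> T (mulop psi F) = mulop psi (T F).
Proof. by move=> [mp p1]; exact: (commute_mulop A_sigma_algebra A_sub bT TA). Qed.

Let Ncom psi F : unit_multiplier psi -> N (mulop psi F) = mulop psi (N F).
Proof. by move=> [mp p1]; exact: (commute_mulop A_sigma_algebra A_sub bN NA). Qed.

Let N'com psi F : unit_multiplier psi -> N' (mulop psi F) = mulop psi (N' F).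
Proof.
move=> up; apply: (adjoint_comm NN'); first exact: unit_multiplierP.
by move=> G; apply: Ncom; exact: unit_multiplier_conj.
Qed.

Variable F : H.
Let G := N' F.
Let K := N F.

(** A common damping factor, which turns [a F], [a G], [a K] into bounded
    multipliers. *)
Let m (x : X) : R := (1 + (nsq (a F x) + (nsq (a G x) + nsq (a K x)))) `^ (-1).

Let total_ge0 x : 0 <= nsq (a F x) + (nsq (a G x) + nsq (a K x)).
Proof. exact: addr_ge0 (nsq_ge0 _) (addr_ge0 (nsq_ge0 _) (nsq_ge0 _)). Qed.

Let m_gt0 x : 0 < m x.
Proof. by apply: powR_gt0; apply: ltr_pwDl => //; exact: total_ge0. Qed.

Let damped (Y : H) (x : X) : C := (m x)%:C%C * a Y x.

Let damped_unit (Y : H) : (forall x, nsq (a Y x) <= nsq (a F x) + (nsq (a G x) + nsq (a K x))) ->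
  unit_multiplier (damped Y).
Proof.
move=> hY; split.
  apply: cmeasurableM => //; split; last exact: measurable_cst.
  apply: (measurableT_comp (measurable_powR _)).
  apply: measurable_funD; first exact: measurable_cst.
  apply: measurable_funD; first exact: (cmeasurable_nsq (am F)).
  by apply: measurable_funD; [exact: (cmeasurable_nsq (am G))|exact: (cmeasurable_nsq (am K))].
move=> x; rewrite ComplexField.Normc.normcM normc_real_ge0 ?(ltW (m_gt0 x))//.
rewrite /m powR_inv1 ?(addr_ge0 _ (total_ge0 x))// mulrC.
have s0 : 0 < 1 + (nsq (a F x) + (nsq (a G x) + nsq (a K x))).
  by apply: ltr_pwDl => //; exact: total_ge0.
rewrite ler_pdivrMr// mul1r; have := hY x; rewrite {1}nsqE.
have := normc_ge0 (a Y x); set t := normc _; set sum := _ + _.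
by have := sqr_ge0 (t - 1); rewrite !expr2; nra.
Qed.

Let uF : unit_multiplier (damped F).
Proof. by apply: damped_unit => x; rewrite lerDl addr_ge0 ?nsq_ge0. Qed.
Let uG : unit_multiplier (damped G).
Proof. by apply: damped_unit => x; rewrite addrCA lerDl addr_ge0 ?nsq_ge0. Qed.
Let uK : unit_multiplier (damped K).
Proof. by apply: damped_unit => x; rewrite addrA lerDr addr_ge0 ?nsq_ge0. Qed.

(** [T] lets the coefficients through, because they are [A]-measurable; what
    comes out is [a Y * w * a Z - a Z * w * a Y]. *)
Let cross (Y Z : H) : unit_multiplier (damped Y) -> unit_multiplier (damped Z) ->
  T (mulop (damped Y) Z - mulop (damped Z) Y) = 0.
Proof.
move=> uY uZ; rewrite (linear_opB bT.1) !Tcom//; apply/eqP; rewrite subr_eq0; apply/eqP.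
apply/L2_eqP.
apply: (aeq_mp (mulopE (T Z) (unit_multiplierP uY))).
apply: (aeq_mp (mulopE (T Y) (unit_multiplierP uZ))).
apply: (aeq_mp (TE Y)); apply: (aeq_mp (TE Z)).
apply: aeW => x e1 e2 e3 e4 _; rewrite e4 e3 e2 e1 /damped; ring.
Qed.

Let cross_apply (D : H -> H) (Y Z : H) :
  bounded_operator D -> (forall F, T F = 0 -> D F = 0) ->
  (forall psi F, unit_multiplier psi -> D (mulop psi F) = mulop psi (D F)) ->
  unit_multiplier (damped Y) -> unit_multiplier (damped Z) ->
  mulop (damped Y) (D Z) = mulop (damped Z) (D Y).
Proof.
move=> bD Dker Dcom uY uZ; apply/eqP; rewrite -subr_eq0 -!Dcom//; apply/eqP.
by rewrite -(linear_opB bD.1) Dker// cross.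
Qed.

(** This element is killed by [N] and [N'], and lies in the sum of their
    ranges, which are orthogonal to these kernels. *)
Let crossNN' : mulop (damped G) (N F) = mulop (damped K) (N' F).
Proof.
apply/eqP; rewrite -subr_eq0; apply/eqP.
set y := _ - _; have Ty : T y = 0 by rewrite /y -/G -/K cross.
have yE : y = N (mulop (damped G) F) - N' (mulop (damped K) F).
  by rewrite Ncom// N'com.
apply: rip_eq0; rewrite [X in rip X _]yE ripBl (adjoint_rip NN') N'ker// rip0r.
by rewrite ripC -(adjoint_rip NN') Nker// rip0l subrr.
Qed.

Let zero_set : set X := [set x | a F x = 0].

Let A_zero_set : A zero_set.
Proof.
rewrite -(g_sigma_measurableE A_sigma_algebra).
have [mr mi] := am F.
rewrite (_ : zero_set = (fun x => nsq (a F x)) @^-1` [set 0]).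
  by rewrite -[X in measurable X]setTI; apply: (cmeasurable_nsq (am F)).
apply/seteqP; split=> x /=; first by move=> ->; rewrite /nsq /= expr0n addr0.
exact: nsq_eq0.
Qed.

(** Where [a F <> 0] this is the cross-multiplication argument; the [A]-set where
    [a F = 0] is handled apart, [T] vanishing on the restriction of [F] to it. *)
Lemma rank_one_normal : N' (N F) = N (N' F).
Proof.
apply/eqP; rewrite -subr_eq0; apply/eqP; set D := _ - _.
have mF := unit_multiplierP uF.
have aD : mulop (damped F) D = 0.
  rewrite /D (linear_opB (linear_mulop mF)) -/K -/G.
  rewrite (@cross_apply N' F K)// (@cross_apply N F G)//.
  by rewrite -crossNN' subrr.
have mZ : multiplier (indicc R zero_set) by exact: multiplier_set.
have TZ : T (mulop (indicc R zero_set) F) = 0.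
  rewrite TA//; apply/L2_eqP; apply: (aeq_mp (mulopE (T F) mZ)); apply: (aeq_mp (TE F)).
  apply: (aeq_mp (L2_repr0 mu)); apply: aeW => x e1 e2 e3 _; rewrite e3 e2 e1 /indicc indicE.
  case: (boolP (x \in zero_set)) => [|_]; last by rewrite mul0r.
  by rewrite inE /zero_set /= => ->; rewrite !mulr0.
have N'A := adjoint_commutes_with_sets NN' NA.
have ZD : mulop (indicc R zero_set) D = 0.
  rewrite /D (linear_opB (linear_mulop mZ)) -N'A// -NA// -NA// -N'A//.
  by rewrite (Nker TZ) (N'ker TZ) (linear_op0 bN.1) (linear_op0 bN'.1) subrr.
apply/L2_eqP; have := mulopE D mF; have := mulopE D mZ; rewrite aD ZD => h1 h2.
apply: (aeq_mp h1); apply: (aeq_mp h2); apply: (aeq_mp (L2_repr0 mu)).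
apply: aeW => x e1 e2 e3 _; rewrite e1 in e2 e3 *.
have [aF0|aF0] := pselect (a F x = 0).
  by move: e3; rewrite /indicc indicE mem_set// mul1r.
have mx0 : ((m x)%:C%C : C) <> 0 by move=> [] /eqP; rewrite (gt_eqF (m_gt0 x)).
by move/esym/eqP: e2; rewrite !mulf_eq0 => /orP[/orP[]|] /eqP.
Qed.

End rank_one_over_A.

(** * The operator [M_w E M_u] *)

Section weighted_conditional_expectation.
Context d (X : measurableType d) (R : realType).
Variable mu : {measure set X -> \bar R}.
Local Notation C := R[i].
Local Notation H := (L2 mu).
Implicit Types (F G : H) (h : X -> R) (f : X -> C) (B : set X).
Variable A : set (set X).
Hypotheses (A_sigma_algebra : sigma_algebra [set: X] A) (A_sub : A `<=` measurable).
Local Notation XA := (g_sigma_algebraType A).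
Hypothesis A_sigma_finite : sigma_finite [set: XA] (mu : set X -> \bar R).

Let trace_sigma_finite :
  sigma_finite setT (trace_measure mu (measurable_id_trace A_sigma_algebra A_sub)).
Proof. exact: A_sigma_finite. Qed.

Let parts h : measurable_fun setT h ->
  [/\ measurable_fun setT ((EFin \o h)^\+)%E, forall x, (0 <= ((EFin \o h)^\+) x)%E &
      forall x, (((EFin \o h)^\+) x < +oo)%E] /\
  [/\ measurable_fun setT ((EFin \o h)^\-)%E, forall x, (0 <= ((EFin \o h)^\-) x)%E &
      forall x, (((EFin \o h)^\-) x < +oo)%E].
Proof.
move=> mh; have mEh : measurable_fun setT (EFin \o h) by exact/measurable_EFinP.
split; split.
- exact: measurable_funepos.
- by move=> x; exact: funepos_ge0.
- by move=> x; rewrite funeposE /= -EFin_max ltry.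
- exact: measurable_funeneg.
- by move=> x; exact: funeneg_ge0.
- by move=> x; rewrite funenegE /= -EFin_max ltry.
Qed.

Lemma measurable_cond_exp_real h : measurable_fun setT h ->
  measurable_fun setT (cond_exp_real mu A h : XA -> R).
Proof.
move=> /parts[[mp p0 py] [mn n0 ny]].
have [mEp _ _] := cond_exp_ge0P trace_sigma_finite mp p0 py.
have [mEn _ _] := cond_exp_ge0P trace_sigma_finite mn n0 ny.
by apply: measurable_funB; exact: (measurableT_comp (fine_measurable measurableT)).
Qed.

Lemma measurable_cond_exp f : cmeasurable f -> @cmeasurable _ XA R (cond_exp mu A f).
Proof. by move=> [mr mi]; split; exact: measurable_cond_exp_real. Qed.

Lemma cond_exp_real_restrict h1 h2 B : measurable_fun setT h1 -> measurable_fun setT h2 ->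
  A B -> (\forall x \ae mu, h2 x = \1_B x * h1 x) ->
  \forall x \ae mu, cond_exp_real mu A h2 x = \1_B x * cond_exp_real mu A h1 x.
Proof.
move=> /parts[[mp1 p10 p1y] [mn1 n10 n1y]] /parts[[mp2 p20 p2y] [mn2 n20 n2y]] AB h21.
have ep : \forall x \ae mu, ((EFin \o h2)^\+)%E x = (((EFin \o h1)^\+)%E \_ B) x.
  apply: filterS h21 => x; rewrite patchE !funeposE indicE /= => ->.
  by case: ifP; rewrite ?mul1r ?mul0r ?maxxx.
have en : \forall x \ae mu, ((EFin \o h2)^\-)%E x = (((EFin \o h1)^\-)%E \_ B) x.
  apply: filterS h21 => x; rewrite patchE !funenegE indicE /= => ->.
  by case: (x \in B) => /=; [rewrite mul1r|rewrite mul0r oppr0 maxxx].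
have := cond_exp_ge0_restrict trace_sigma_finite mp1 p10 p1y mp2 p20 p2y AB ep.
have := cond_exp_ge0_restrict trace_sigma_finite mn1 n10 n1y mn2 n20 n2y AB en.
apply: filterS2 => x e1 e2; rewrite /cond_exp_real e1 e2 !patchE indicE.
by case: ifP => _; rewrite ?mul1r ?mul0r ?subrr.
Qed.

Variables (u w : X -> C) (T : H -> H).
Hypothesis T_def : is_MwEMu A w u T.

(** Conditional expectations commute with the restriction to an [A]-set.  Here
    the restricted class has a representative known only almost everywhere,
    hence the form of [cond_exp_real_restrict]. *)
Lemma MwEMu_commutes_with_sets : commutes_with_sets A T.
Proof.
move=> B AB F; apply/L2_eqP; set F1 := mulop _ F.
have mB : multiplier (indicc R B) := multiplier_set R A_sub AB.
have [[[mr mi] _] TF] := T_def F; have [[[mr1 mi1] _] TF1] := T_def F1.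
have eF1 := mulopE F mB.
have er := cond_exp_real_restrict mr mr1 AB.
have ei := cond_exp_real_restrict mi mi1 AB.
have {}er : \forall x \ae mu, cond_exp_real mu A (fun y => Re (u y * F1 y)) x =
    \1_B x * cond_exp_real mu A (fun y => Re (u y * F y)) x.
  apply: er; apply: filterS eF1 => x e; rewrite e// /indicc.
  by case: (u x) (F x) => ? ? [? ?] /=; ring.
have {}ei : \forall x \ae mu, cond_exp_real mu A (fun y => Im (u y * F1 y)) x =
    \1_B x * cond_exp_real mu A (fun y => Im (u y * F y)) x.
  apply: ei; apply: filterS eF1 => x e; rewrite e// /indicc.
  by case: (u x) (F x) => ? ? [? ?] /=; ring.
apply: (aeq_mp TF); apply: (aeq_mp TF1); apply: (aeq_mp (mulopE (T F) mB)).
apply: filterS2 er ei => x e1 e2 e3 e4 e5 _.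
rewrite e4 e3 e5 /cond_exp e1 e2 /indicc mulrCA; congr (_ * _).
by apply/eqP; rewrite eq_complex /= !mul0r subr0 addr0 !eqxx.
Qed.

End weighted_conditional_expectation.

(** * The generalized Aluthge transformation *)

Section aluthge.
Context d (X : measurableType d) (R : realType).
Variable mu : {measure set X -> \bar R}.
Local Notation C := R[i].
Local Notation H := (L2 mu).
Implicit Types (F G : H) (B : set X).

Lemma positive_adjoint_comp (T T' : H -> H) : bounded_operator T -> is_adjoint T T' ->
  positive_op (T' \o T).
Proof.
move=> bT TT'; have [bT' _] := TT'; split; first exact: bounded_operator_comp.
  by move=> F G /=; rewrite ripC -!(adjoint_rip TT') ripC.
by move=> F /=; rewrite ripC -(adjoint_rip TT') rip_ge0.
Qed.

Variable A : set (set X).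
Hypotheses (A_sub : A `<=` measurable).

Lemma mulop_set_adjoint B : A B ->
  is_adjoint (@mulop _ _ _ mu (indicc R B)) (@mulop _ _ _ mu (indicc R B)).
Proof.
by move=> AB; have := mulop_adjoint mu (multiplier_set R A_sub AB); rewrite indicc_conj.
Qed.

Lemma power_commutes_with_sets (S P : H -> H) (s : R) : positive_op S -> 0 <= s ->
  is_power S s P -> commutes_with_sets A S -> commutes_with_sets A P.
Proof.
move=> posS s0 SP SA B AB F; apply/esym.
by apply: (is_power_comm posS s0 SP (bounded_mulop mu (multiplier_set R A_sub AB))
  (mulop_set_adjoint AB)) => G; rewrite SA.
Qed.

End aluthge.

Theorem theorem2p1 (R : realType) (d : measure_display) (X : measurableType d)
    (mu : {measure set X -> \bar R}) (A : set (set X))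
    (mu_complete : measure_is_complete mu)
    (mu_sigma_finite : sigma_finite [set: X] mu)
    (A_sigma_algebra : sigma_algebra [set: X] A)
    (A_sub : A `<=` measurable)
    (A_sigma_finite : sigma_finite [set: g_sigma_algebraType A]
                                   (mu : set X -> \bar R))
    (u w : X -> R[i])
    (u_dom : cond_exp_dom mu A u) (w_dom : cond_exp_dom mu A w)
    (T : L2 mu -> L2 mu)
    (T_def : is_MwEMu A w u T) (T_bounded : bounded_operator T)
    (U absT : L2 mu -> L2 mu) (T_polar : polar_decomposition T U absT)
    (r t : R) (r_gt0 : 0 < r) (t_ge0 : 0 <= t) (t_le_r : t <= r)
    (absT_t absT_rt : L2 mu -> L2 mu)
    (absT_tE : is_power absT t absT_t)
    (absT_rtE : is_power absT (r - t) absT_rt) :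
  normal_operator (absT_t \o U \o absT_rt).
Proof.
have [[T' TT' absTE] [bU _] TU _] := T_polar.
have posS := positive_adjoint_comp T_bounded TT'.
have half_gt0 : 0 < (2^-1 : R) by rewrite invr_gt0.
have pos_absT : positive_op absT.
  move: absTE; rewrite /is_power gt_eqF// => h.
  exact: (power_positive posS half_gt0 h).
have rt_ge0 : 0 <= r - t by rewrite subr_ge0.
have TA := MwEMu_commutes_with_sets A_sigma_algebra A_sub A_sigma_finite T_def.
have T'A := adjoint_commutes_with_sets A_sub TT' TA.
have SA : commutes_with_sets A (T' \o T) by move=> B AB F /=; rewrite TA// T'A.
have absTA := power_commutes_with_sets A_sub posS (ltW half_gt0) absTE SA.
have absT_tA := power_commutes_with_sets A_sub pos_absT t_ge0 absT_tE absTA.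
have absT_rtA := power_commutes_with_sets A_sub pos_absT rt_ge0 absT_rtE absTA.
have absT_ker F : T F = 0 -> absT F = 0.
  move=> TF0; apply: (is_power_kernel posS (ltW half_gt0) absTE) => /=.
  by rewrite TF0; exact: linear_op0 TT'.1.1.
have b_t := is_power_bounded pos_absT absT_tE.
have b_rt := is_power_bounded pos_absT absT_rtE.
(* [T = U absT] determines [U] on the closure of the range of [absT], which
   contains the range of [absT_rt] *)
have U_rtA B : A B -> forall F,
    U (mulop (indicc R B) (absT_rt F)) = mulop (indicc R B) (U (absT_rt F)).
  move=> AB F; have bB := bounded_mulop mu (multiplier_set R A_sub AB).
  pose D G := (-1) *: mulop (indicc R B) (U G) + U (mulop (indicc R B) G).
  have bD : bounded_operator D.
    exact: bounded_operator_axpy (bounded_operator_comp bB bU) (bounded_operator_comp bU bB).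
  have DabsT G : D (absT G) = 0.
    by rewrite /D -absTA// -!TU TA// scaleN1r addNr.
  have := is_power_vanish pos_absT rt_ge0 absT_rtE bD DabsT F.
  by rewrite /D scaleN1r addrC => /eqP; rewrite subr_eq0 => /eqP.
set N := absT_t \o U \o absT_rt.
have bN : bounded_operator N by do 2 apply: bounded_operator_comp => //.
split=> //; have [N' NN'] := adjoint_exists bN; exists N' => //.
apply: (rank_one_normal A_sigma_algebra A_sub T_bounded
  (a := fun F => cond_exp mu A (fun y => u y * F y)) (w := w)) => //.
- move=> F; apply: measurable_cond_exp => //.
  by have [[]] := T_def F.
- by move=> F; have [] := T_def F.
- by move=> B AB F; rewrite /N /= absT_rtA// U_rtA// absT_tA.
- move=> F /absT_ker absF; rewrite /N /=.
  rewrite (is_power_kernel pos_absT rt_ge0 absT_rtE absF).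
  by rewrite (linear_op0 bU.1) (linear_op0 b_t.1).
move=> F /absT_ker absF; apply: rip_inj => G.
rewrite ripC -(adjoint_rip NN') /N /=.
rewrite (is_power_selfadjoint pos_absT t_ge0 absT_tE).
by rewrite (is_power_kernel pos_absT t_ge0 absT_tE absF) rip0r rip0l.
Qed.
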